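(* For every integer $n\ge 66$ with $n\equiv 2 \pmod 8$ there exists a cyclically $5$-connected strictly critical snark of girth $6$ and order $n$.
   Context: A snark is a connected cubic graph with chromatic index $4$. A snark is critical if, for every pair of distinct adjacent vertices, the graph obtained by removing these two vertices is $3$-edge-colourable; it is bicritical if the same holds for every pair of distinct vertices; it is strictly critical if it is critical but not bicritical. A cubic graph is cyclically $k$-connected if no set of fewer than $k$ edges separates two cycles of the graph from each other. The girth is the length of a shortest cycle. *)

(* Defs.v *)
From mathcomp Require Import all_boot.
Set Implicit Arguments.
Unset Strict Implicit.
Unset Printing Implicit Defensive.

Record sgraph := SGraph {
  vert :> finType;
  adj : rel vert;
  adj_sym : symmetric adj;
  adj_irrefl : irreflexive adj
}.

Section Graph.
Variable G : sgraph.

Definition edges : {set {set G}} :=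
  [set [set p.1; p.2] | p : G * G & adj p.1 p.2].

Definition cubic : Prop := forall x : G, #|[set y | adj x y]| = 3.

Definition connected : Prop := forall x y : G, connect (@adj G) x y.

(* Colours are natural numbers below k; values of c outside [edges] are
   irrelevant. *)
Definition edge_colourable (k : nat) : Prop :=
  exists c : {set G} -> nat,
    (forall e, e \in edges -> c e < k) /\
    (forall e f, e \in edges -> f \in edges -> e != f ->
       e :&: f != set0 -> c e != c f).

Definition has_chromatic_index (k : nat) : Prop :=
  edge_colourable k /\ forall j, edge_colourable j -> k <= j.

(* A cycle is given by the sequence of its vertices; its length is the size
   of the sequence. *)
Definition graph_cycle (s : seq G) : Prop :=
  3 <= size s /\ ucycle (@adj G) s.

Definition has_girth (g : nat) : Prop :=
  (exists2 s, graph_cycle s & size s = g) /\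
  (forall s, graph_cycle s -> g <= size s).

Definition del_edges (F : {set {set G}}) : rel G :=
  [rel x y | adj x y && ([set x; y] \notin F)].

(* As [connect] is reflexive, separated cycles are vertex-disjoint. *)
Definition separates (F : {set {set G}}) (s t : seq G) : Prop :=
  forall x y, x \in s -> y \in t -> ~~ connect (del_edges F) x y.

Definition cyclically_connected (k : nat) : Prop :=
  forall F : {set {set G}}, F \subset edges -> #|F| < k ->
  ~ exists s t, [/\ graph_cycle s, graph_cycle t & separates F s t].

Section Induced.
Variable S : {set G}.

Definition induced_adj : rel {x : G | x \in S} :=
  [rel x y | adj (val x) (val y)].

Lemma induced_sym : symmetric induced_adj.
Proof. by move=> x y; apply: adj_sym. Qed.

Lemma induced_irrefl : irreflexive induced_adj.
Proof. by move=> x; apply: adj_irrefl. Qed.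

Definition induced : sgraph := SGraph induced_sym induced_irrefl.

End Induced.

End Graph.

Definition remove_pair (G : sgraph) (u v : G) : sgraph :=
  induced (~: [set u; v]).

Definition snark (G : sgraph) : Prop :=
  [/\ connected G, cubic G & has_chromatic_index G 4].

Definition critical (G : sgraph) : Prop :=
  forall u v : G, u != v -> adj u v -> edge_colourable (remove_pair u v) 3.

Definition bicritical (G : sgraph) : Prop :=
  forall u v : G, u != v -> edge_colourable (remove_pair u v) 3.

Definition strictly_critical (G : sgraph) : Prop :=
  critical G /\ ~ bicritical G.

(* Main.v *)
Require Import Defs.
From Stdlib Require Import BinPos.
From mathcomp Require Import all_boot.
From mathcomp Require Import zify.

Set Implicit Arguments.
Unset Strict Implicit.
Unset Printing Implicit Defensive.

(* Deleting a vertex and severing an edge of a flower snark leaves a pole with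
   3 + 2 dangling edges, in no 3-edge-colouring of which the two halves of the
   severed edge have the same colour.  The graph consists of three such poles, a
   hexagon and three further vertices.  The severed edges of a pole are attached
   to two opposite vertices of the hexagon, and each of the three further
   vertices is adjacent to all three poles.  In a 3-edge-colouring of a hexagon
   with six dangling edges, the number of opposite pairs of dangling edges with
   distinct colours is even, so poles and hexagon together are not 3-edge-
   colourable, even without the three further vertices.  Hence the graph is a
   snark and removing two of the latter does not make it colourable.

   A flower snark is a closed chain of blocks, each a hub joined to a vertex on
   each of three rails.  Going back through a block and forth again prolongs a
   colouring by two blocks, that is, by eight vertices.  So one pole can be made
   arbitrarily long, and the colourings that prove criticality are needed only
   for short chains.

   Cyclic connectivity, girth and connectedness all follow from one statement on
   cuts: if X and its complement have at least 3 vertices, then at least 5 edges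
   leave X, and at least 6 if |X| = 5.  (A cycle of length l is left by at most l
   edges.)  It is proved by dynamic programming over the vertices, with a set of
   states for the chain that is closed under adding a block. *)

(** * Colourings of graphs with indexed edges *)

Section Colourings.
Variables (G : sgraph) (k : nat).

(** Colourings of the subgraph induced by [S], kept on the edges of [G] so that no subtype is
    involved. *)
Definition colouring_on (S : {set G}) (c : {set G} -> nat) : Prop :=
  (forall e, e \in edges G -> e \subset S -> c e < k) /\
  (forall e f, e \in edges G -> f \in edges G -> e \subset S -> f \subset S ->
     e != f -> e :&: f != set0 -> c e != c f).

Lemma edgesP (e : {set G}) :
  reflect (exists x y, adj x y /\ e = [set x; y]) (e \in edges G).
Proof.
apply: (iffP imsetP) => [[[x y]]|[x [y [xy ->]]]].
  by rewrite inE => xy ->; exists x, y.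
by exists (x, y); rewrite ?inE.
Qed.

Lemma edge_colourableP :
  edge_colourable G k <-> exists c, colouring_on [set: G] c.
Proof.
split=> -[c [c1 c2]]; exists c; split=> *.
- exact: c1.
- exact: c2.
- by apply: c1; rewrite ?subsetT.
- by apply: c2; rewrite ?subsetT.
Qed.

Lemma colouring_onS (S T : {set G}) c :
  S \subset T -> colouring_on T c -> colouring_on S c.
Proof.
move=> sST [c1 c2]; split=> [e eG eS|e f eG fG eS fS].
  by apply: c1 => //; apply: subset_trans sST.
by apply: c2 => //; apply: subset_trans sST.
Qed.

Definition ival (S : {set G}) (x : induced S) : G := val x.

Lemma induced_edgeP (S : {set G}) (e : {set induced S}) :
  e \in edges (induced S) ->
  @ival S @: e \in edges G /\ @ival S @: e \subset S.
Proof.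
case/imsetP=> -[x y]; rewrite inE /= => xy ->.
rewrite imsetU1 imset_set1; split.
  by apply/edgesP; exists (val x), (val y).
by apply/subsetP => z; rewrite !inE => /orP[]/eqP->; apply: valP.
Qed.

(** Colourings are transported along preimages of edges in one direction and along images in the
    other. *)
Lemma edge_colourable_induced (S : {set G}) :
  edge_colourable (induced S) k <-> exists c, colouring_on S c.
Proof.
split=> [[c [c1 c2]]|[c [c1 c2]]].
  pose r (e : {set G}) : {set induced S} := [set x | ival x \in e].
  have rE e : e \in edges G -> e \subset S -> r e \in edges (induced S).
    case/edgesP=> x [y [xy ->]] sS.
    have xS : x \in S by rewrite (subsetP sS) ?inE ?eqxx.
    have yS : y \in S by rewrite (subsetP sS) ?inE ?eqxx ?orbT.
    apply/imsetP; exists (Sub x xS, Sub y yS); first by rewrite inE.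
    by apply/setP => z; rewrite !inE -!val_eqE.
  exists (fun e => c (r e)); split=> [e eG eS|e f eG fG eS fS nef].
    exact/c1/rE.
  case/set0Pn=> x; rewrite inE => /andP[xe xf].
  have xS : x \in S by apply: (subsetP eS).
  apply: c2; rewrite ?rE //; last first.
    by apply/set0Pn; exists (Sub x xS); rewrite !inE /= xe xf.
  (* An edge inside [S] is recovered from its preimage, so distinct edges have distinct
     preimages. *)
  apply: contra nef => /eqP/setP eqr; apply/eqP/setP => z.
  have [zS|zS] := boolP (z \in S).
    by have := eqr (Sub z zS); rewrite !inE.
  by rewrite (contraNF (subsetP eS z) zS) (contraNF (subsetP fS z) zS).
exists (fun e : {set induced S} => c (@ival S @: e)).
split=> [e /induced_edgeP[]|e f].
  exact: c1.
move=> /induced_edgeP[eG eS] /induced_edgeP[fG fS] nef ef.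
apply: c2 => //.
  by apply: contra nef => /eqP/(imset_inj val_inj)->.
case/set0Pn: ef => x; rewrite inE => /andP[xe xf].
by apply/set0Pn; exists (ival x); rewrite inE !imset_f.
Qed.

End Colourings.

(** * Graphs with named edges and incidence lists *)

Section EdgeIndexed.

Variables (V E : finType) (src tgt : E -> V) (inc : V -> seq E).

Definition ends e : {set V} := [set src e; tgt e].

Hypothesis ends_inj : injective ends.
Hypothesis src_neq_tgt : forall e, src e != tgt e.
Hypothesis mem_inc : forall v e, (e \in inc v) = (v \in ends e).
Hypothesis inc_uniq : forall v, uniq (inc v).
Hypothesis size_inc : forall v, size (inc v) = 3.

Definition iadj : rel V := [rel v w | [exists e, ends e == [set v; w]]].

Lemma iadj_sym : symmetric iadj.
Proof. by move=> v w; apply: eq_existsb => e; rewrite setUC. Qed.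

Lemma card_ends e : #|ends e| = 2.
Proof. by rewrite cards2 src_neq_tgt. Qed.

Lemma iadj_irrefl : irreflexive iadj.
Proof.
move=> v; apply/existsP => -[e /eqP eE].
by have := card_ends e; rewrite eE cards2 eqxx.
Qed.

Definition igraph : sgraph := SGraph iadj_sym iadj_irrefl.

Lemma iadjP v w : reflect (exists e, ends e = [set v; w]) (iadj v w).
Proof. by apply: (iffP existsP) => -[e /eqP]; exists e => //; apply/eqP. Qed.

Lemma iadj_ends e : iadj (src e) (tgt e).
Proof. by apply/iadjP; exists e. Qed.

Lemma mem_edges_igraph (A : {set V}) :
  reflect (exists e, A = ends e) (A \in edges igraph).
Proof.
apply: (iffP (@edgesP igraph A)) => [[x [y [/iadjP[e <-] ->]]]|[e ->]].
  by exists e.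
by exists (src e), (tgt e); split; first exact: iadj_ends.
Qed.

Definition opposite v e := if src e == v then tgt e else src e.

Lemma ends_opposite v e : v \in ends e -> ends e = [set v; opposite v e].
Proof.
rewrite /opposite !inE => /orP[]/eqP->; first by rewrite eqxx.
by rewrite (negPf (src_neq_tgt e)) setUC.
Qed.

Lemma opposite_eq v w e : ends e = [set v; w] -> opposite v e = w.
Proof.
move=> eE; have ve : v \in ends e by rewrite eE !inE eqxx.
have : w \in ends e by rewrite eE !inE eqxx orbT.
rewrite (ends_opposite ve) !inE => /orP[/eqP wv|/eqP->//].
by have := card_ends e; rewrite eE wv cards2 eqxx.
Qed.

Lemma igraph_cubic : cubic igraph.
Proof.
move=> v; rewrite -(size_inc v).
have -> : [set w | iadj v w] = [set opposite v e | e in inc v].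
  apply/setP=> w; rewrite inE; apply/iadjP/imsetP => [[e eE]|[e ve ->]].
    by exists e; rewrite ?(opposite_eq eE) // mem_inc eE !inE eqxx.
  by exists e; rewrite -ends_opposite // -mem_inc.
rewrite card_in_imset; first by apply/card_uniqP.
move=> e f; rewrite !mem_inc => ve vf eqo; apply: ends_inj.
by rewrite (ends_opposite ve) (ends_opposite vf) eqo.
Qed.

(** Two edges inside [S] that meet do so in a vertex of [S], so distinct colours along the incidence
    lists of [S] are enough. *)
Lemma igraph_colouring k (S : {set V}) (g : E -> nat) :
  (forall e, g e < k) ->
  (forall v, v \in S -> uniq (map g (inc v))) ->
  exists c, @colouring_on igraph k S c.
Proof.
move=> gk gu.
pose c (A : {set V}) := if [pick e | ends e == A] is Some e then g e else 0.
have cE e : c (ends e) = g e.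
  rewrite /c; case: pickP => [f /eqP/ends_inj->//|/(_ e)].
  by rewrite eqxx.
exists c; split=> [A /mem_edges_igraph[e ->] _|]; first by rewrite cE.
move=> A B /mem_edges_igraph[e ->] /mem_edges_igraph[f ->] eS fS nef.
rewrite !cE => /set0Pn[v]; rewrite inE => /andP[ve vf].
have vS := subsetP eS v ve; apply: contra nef => /eqP gef; apply/eqP.
congr ends.
have /(nth_index e) := introT idP (etrans (mem_inc v e) ve).
have /(nth_index e) := introT idP (etrans (mem_inc v f) vf).
move: (gu v vS); rewrite -mem_inc in ve; rewrite -mem_inc in vf.
move=> /(uniqP 0) inj fE eE; rewrite -eE -fE; congr nth.
apply: inj; rewrite ?inE ?size_map ?index_mem //.
by rewrite !(nth_map e) ?index_mem // eE fE.
Qed.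

(* An edge with a removed end gets the colour missing at its other end. *)
Lemma colouring_on_extend (S : {set V}) (c : {set V} -> nat) :
  @colouring_on igraph 3 S c ->
  (forall v, v \in S -> count (fun e => ~~ (ends e \subset S)) (inc v) <= 1) ->
  exists2 g : E -> nat, (forall v, v \in S -> all (fun e => g e < 3) (inc v)) &
    forall v, v \in S -> uniq (map g (inc v)).
Proof.
move=> [c1 c2] cnt.
pose good e := ends e \subset S.
(* The three colours add up to 3, so the missing one is 3 minus the sum of the two colours at the
   surviving end. *)
pose g e := if good e then c (ends e) else
  3 - \sum_(f | good f && (ends f :&: ends e != set0)) c (ends f).
have cG e : good e -> c (ends e) < 3.
  by move=> ge; apply: c1 => //; apply/mem_edges_igraph; exists e.
have cN e f v : good e -> good f -> e != f -> e \in inc v -> f \in inc v ->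
    c (ends e) != c (ends f).
  rewrite !mem_inc => ge gf nef ve vf; apply: c2 => //.
  - by apply/mem_edges_igraph; exists e.
  - by apply/mem_edges_igraph; exists f.
  - by apply: contra nef => /eqP/ends_inj->.
  - by apply/set0Pn; exists v; rewrite inE ve.
have gE e : good e -> g e = c (ends e) by rewrite /g => ->.
have gB v e1 e2 e : v \in S -> inc v =i [:: e1; e2; e] -> e1 != e2 ->
    good e1 -> good e2 -> ~~ good e ->
    [/\ g e < 3, g e != g e1 & g e != g e2].
  move=> vS incE n12 g1 g2 ge.
  have i1 : e1 \in inc v by rewrite incE !inE eqxx.
  have i2 : e2 \in inc v by rewrite incE !inE eqxx ?orbT.
  have ve : v \in ends e by rewrite -mem_inc incE !inE eqxx !orbT.
  have gsum : \sum_(f | good f && (ends f :&: ends e != set0)) c (ends f) =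
      c (ends e1) + c (ends e2).
    rewrite (bigD1 e1) /=; last first.
      by rewrite g1; apply/set0Pn; exists v; rewrite inE ve -mem_inc i1.
    rewrite (bigD1 e2) /=; last first.
      rewrite g2 (eq_sym e2) n12 andbT; apply/set0Pn; exists v.
      by rewrite inE ve -mem_inc i2.
    (* A third edge inside [S] meeting [e] would do so at the opposite end, and then [e] itself
       would lie inside [S]. *)
    rewrite big1 ?addn0 // => f /andP[/andP[/andP[gf fe] nf1] nf2].
    case/set0Pn: fe => w; rewrite inE => /andP[wf we].
    have : w \in ends e by [].
    rewrite (ends_opposite ve) !inE => /orP[]/eqP wE.
      move: wf; rewrite wE -mem_inc incE !inE (negPf nf1) (negPf nf2) /=.
      by move/eqP=> fe; rewrite -fe gf in ge.
    case/negP: ge; rewrite /good (ends_opposite ve) -wE.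
    by apply/subsetP => z; rewrite !inE => /orP[]/eqP-> //; apply: (subsetP gf).
  have := cN _ _ _ g1 g2 n12 i1 i2; have := cG _ g1; have := cG _ g2.
  rewrite (gE _ g1) (gE _ g2) /g (negPf ge) gsum.
  by split; lia.
(* At most one of the three edges at [v] leaves [S], so only four of the eight cases survive. *)
have key v : v \in S -> all (fun e => g e < 3) (inc v) && uniq (map g (inc v)).
  move=> vS; have := cnt v vS; have := size_inc v; have := inc_uniq v.
  have gBv e1 e2 e := @gB v e1 e2 e vS.
  have cNv e f := @cN e f v.
  case: (inc v) gBv cNv => [|a [|b [|d []]]] //= gBv cNv.
  rewrite !inE !negb_or !andbT -!/(good _) => /andP[/andP[nab nad] nbd] _.
  have nba : b != a by rewrite eq_sym.
  have nda : d != a by rewrite eq_sym.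
  have ndb : d != b by rewrite eq_sym.
  have ia : a \in [:: a; b; d] by rewrite !inE eqxx.
  have ib : b \in [:: a; b; d] by rewrite !inE eqxx orbT.
  have id : d \in [:: a; b; d] by rewrite !inE eqxx !orbT.
  have [ga|ga] := boolP (good a); have [gb|gb] := boolP (good b);
    have [gd|gd] := boolP (good d) => //= _.
  - have n1 := cNv _ _ ga gb nab ia ib; have n2 := cNv _ _ ga gd nad ia id.
    have n3 := cNv _ _ gb gd nbd ib id.
    by rewrite !gE // !cG // n1 n2 n3.
  - have [//|gd3 gda gdb] := gBv a b d _ nab ga gb gd.
    have n1 := cNv _ _ ga gb nab ia ib.
    rewrite gd3 !(eq_sym _ (g d)) gda gdb /= !gE //.
    by rewrite !cG // n1.
  - have [z|gd3 gda gdb] := gBv a d b _ nad ga gd gb.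
      by rewrite !inE; do !case: (z =P _).
    have n1 := cNv _ _ ga gd nad ia id.
    by rewrite gd3 (eq_sym _ (g b)) gda gdb /= !gE // !cG // n1.
  - have [z|gd3 gda gdb] := gBv b d a _ nbd gb gd ga.
      by rewrite !inE; do !case: (z =P _).
    have n1 := cNv _ _ gb gd nbd ib id.
    by rewrite gd3 gda gdb /= !gE // !cG // n1.
exists g => v /key/andP[] //.
Qed.

End EdgeIndexed.

(** * The graph *)

(* The core is everything but the blocks of the long pole.  Its vertices 0, 1, 2
   are the three vertices adjacent to all poles, 3-21 and 22-40 form the two
   short poles, 41-46 the hexagon (in cyclic order 45, 41, 43, 46, 42, 44), and
   47-49 what remains of the block of the deleted vertex in the long pole.  Of
   each edge the smaller end comes first. *)
Definition core_ends : seq (nat * nat) :=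
  [:: (2, 3); (3, 4); (3, 5); (0, 7); (6, 7); (4, 8); (6, 8); (5, 9); (6,
   9); (7, 11); (10, 11); (8, 12); (10, 12); (9, 13); (10, 13); (11, 15);
   (14, 15); (12, 16); (14, 16); (13, 17); (14, 17); (1, 19); (15, 19); (18,
   19); (16, 20); (18, 20); (4, 21); (17, 21); (18, 21); (2, 22); (22, 23);
   (22, 24); (0, 26); (25, 26); (23, 27); (25, 27); (24, 28); (25, 28); (26,
   30); (29, 30); (27, 31); (29, 31); (28, 32); (29, 32); (30, 34); (33,
   34); (31, 35); (33, 35); (32, 36); (33, 36); (1, 38); (34, 38); (37, 38);
   (35, 39); (37, 39); (23, 40); (36, 40); (37, 40); (5, 41); (20, 42); (24,
   43); (41, 43); (39, 44); (42, 44); (41, 45); (44, 45); (42, 46); (43,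
   46); (2, 47); (47, 48); (45, 49); (47, 49)].

(** The position in the list is the rail. Rail 0 leads to 0 and 1 in place of the deleted vertex; 48
    joins rail 1 on the left to rail 2 on the right, the twist of the flower snark; the severed edge
    leaves 49 attached to 45 and the right end of rail 1 attached to 46. *)
Definition left_ends : seq nat := [:: 0; 48; 49].
Definition right_ends : seq nat := [:: 1; 46; 48].

(** Agreement of this table with the three lists of ends is checked in [core_inc_spec]. *)
Definition core_inc : seq (seq nat) :=
  [:: [:: 3; 32; 72]; [:: 21; 50; 75]; [:: 0; 29; 68]; [:: 0; 1; 2]; [:: 1;
   5; 26]; [:: 2; 7; 58]; [:: 4; 6; 8]; [:: 3; 4; 9]; [:: 5; 6; 11]; [:: 7;
   8; 13]; [:: 10; 12; 14]; [:: 9; 10; 15]; [:: 11; 12; 17]; [:: 13; 14;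
   19]; [:: 16; 18; 20]; [:: 15; 16; 22]; [:: 17; 18; 24]; [:: 19; 20; 27];
   [:: 23; 25; 28]; [:: 21; 22; 23]; [:: 24; 25; 59]; [:: 26; 27; 28]; [::
   29; 30; 31]; [:: 30; 34; 55]; [:: 31; 36; 60]; [:: 33; 35; 37]; [:: 32;
   33; 38]; [:: 34; 35; 40]; [:: 36; 37; 42]; [:: 39; 41; 43]; [:: 38; 39;
   44]; [:: 40; 41; 46]; [:: 42; 43; 48]; [:: 45; 47; 49]; [:: 44; 45; 51];
   [:: 46; 47; 53]; [:: 48; 49; 56]; [:: 52; 54; 57]; [:: 50; 51; 52]; [::
   53; 54; 62]; [:: 55; 56; 57]; [:: 58; 61; 64]; [:: 59; 63; 66]; [:: 60;
   61; 67]; [:: 62; 63; 65]; [:: 64; 65; 70]; [:: 66; 67; 76]; [:: 68; 69;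
   71]; [:: 69; 73; 77]; [:: 70; 71; 74]].

Definition core_src e := (nth (0, 0) core_ends e).1.
Definition core_tgt e := (nth (0, 0) core_ends e).2.

Lemma iota_all n (P : nat -> bool) : all P (iota 0 n) -> forall a, a < n -> P a.
Proof. by move/allP=> h a an; apply: h; rewrite mem_iota. Qed.

Lemma core_src_lt e : e < 72 -> core_src e < 50.
Proof. by apply: (@iota_all 72 (fun e => core_src e < 50)). Qed.

Lemma core_tgt_lt e : e < 72 -> core_tgt e < 50.
Proof. by apply: (@iota_all 72 (fun e => core_tgt e < 50)). Qed.

Lemma left_end_lt (x : 'I_3) : nth 0 left_ends x < 50.
Proof. by case: x => -[|[|[]]]. Qed.

Lemma right_end_lt (x : 'I_3) : nth 0 right_ends x < 50.
Proof. by case: x => -[|[|[]]]. Qed.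

Lemma core_inc_spec a : a < 50 ->
  [/\ size (nth [::] core_inc a) = 3, uniq (nth [::] core_inc a) &
   forall c, c \in nth [::] core_inc a =
     if c < 72 then (core_src c == a) || (core_tgt c == a)
     else if c < 75 then nth 0 left_ends (c - 72) == a
     else (c < 78) && (nth 0 right_ends (c - 75) == a)].
Proof.
pose spec a c := if c < 72 then (core_src c == a) || (core_tgt c == a)
     else if c < 75 then nth 0 left_ends (c - 72) == a
     else (c < 78) && (nth 0 right_ends (c - 75) == a).
(* All entries lie below 78, so a finite test settles membership for every code. *)
pose ok a := let s := nth [::] core_inc a in
  [&& size s == 3, uniq s, all (gtn 78) s & 
   all (fun c => (c \in s) == spec a c) (iota 0 78)].
move=> aP; have /and4P[/eqP s3 us /allP lt78 /allP sE] : ok a.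
  by move: a aP; apply: iota_all; vm_compute.
split=> // c; have [c78|c78] := ltnP c 78.
  by have /eqP-> : _ == _ := sE c (etrans (mem_iota 0 78 c) c78); rewrite /spec c78.
rewrite !ifF; try by lia.
by apply/negP => /lt78 /=; lia.
Qed.

Lemma core_inc_lt a c : a < 50 -> c \in nth [::] core_inc a -> c < 78.
Proof.
by move=> /core_inc_spec[_ _ ->]; do 2![case: ltnP => ? //]; lia.
Qed.

Lemma core_inc_edge a e : a < 50 -> e < 72 ->
  (e \in nth [::] core_inc a) = (core_src e == a) || (core_tgt e == a).
Proof. by move=> /core_inc_spec[_ _ ->] ->. Qed.

Lemma core_inc_link0 a (x : 'I_3) : a < 50 ->
  (72 + x \in nth [::] core_inc a) = (nth 0 left_ends x == a).
Proof.
move=> /core_inc_spec[_ _ ->]; have x3 := ltn_ord x.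
have -> : (72 + x < 72) = false by lia.
by rewrite (_ : 72 + x < 75) ?addKn //; lia.
Qed.

Lemma core_inc_link_max a (x : 'I_3) : a < 50 ->
  (75 + x \in nth [::] core_inc a) = (nth 0 right_ends x == a).
Proof.
move=> /core_inc_spec[_ _ ->]; have x3 := ltn_ord x.
have -> : (75 + x < 72) = false by lia.
have -> : (75 + x < 75) = false by lia.
have -> : 75 + x < 78 by lia.
by rewrite addKn.
Qed.

(** Serves [ends_inj]: the core has no parallel edges. *)
Lemma core_ends_simple :
  all (fun e => all (fun f => (e == f) ||
    ~~ ((core_src f \in [:: core_src e; core_tgt e]) &&
        (core_tgt f \in [:: core_src e; core_tgt e]))) (iota 0 72)) (iota 0 72).
Proof. by vm_compute. Qed.

Definition vertex m : finType := ('I_50 + ('I_m + 'I_m * 'I_3))%type.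
(** Link triple [i] precedes block [i], and triple [m] follows the last block. *)
Definition edge m : finType := ('I_72 + ('I_m * 'I_3 + 'I_m.+1 * 'I_3))%type.

Lemma card_vertex m : #|vertex m| = 50 + 4 * m.
Proof. by rewrite !card_sum card_prod !card_ord; lia. Qed.

Section Graph.
Variable m : nat.

Definition core (a : nat) : vertex m := inl (inord a).
Definition hub (i : 'I_m) : vertex m := inr (inl i).
Definition rail (i : 'I_m) (x : 'I_3) : vertex m := inr (inr (i, x)).

Definition core_edge (e : nat) : edge m := inl (inord e).
Definition spoke (i : 'I_m) (x : 'I_3) : edge m := inr (inl (i, x)).
Definition link (i : 'I_m.+1) (x : 'I_3) : edge m := inr (inr (i, x)).

(** Here [unlift ord0 i] is the block before link [i], and [unlift ord_max i] in [tgt] the block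
    after it; [None] marks an end of the chain, attached to the core. *)
Definition src (e : edge m) : vertex m :=
  match e with
  | inl e => core (core_src e)
  | inr (inl (i, x)) => hub i
  | inr (inr (i, x)) =>
      if unlift ord0 i is Some j then rail j x else core (nth 0 left_ends x)
  end.

Definition tgt (e : edge m) : vertex m :=
  match e with
  | inl e => core (core_tgt e)
  | inr (inl (i, x)) => rail i x
  | inr (inr (i, x)) =>
      if unlift ord_max i is Some j then rail j x
      else core (nth 0 right_ends x)
  end.

(* Edge codes at a core vertex: core edges are numbered from 0, the links of
   the left end of the chain from 72, those of the right end from 75. *)
Definition decode (c : nat) : edge m :=
  if c < 72 then core_edge c
  else if c < 75 then link ord0 (inord (c - 72))
  else link ord_max (inord (c - 75)).

Definition ord3 : seq 'I_3 := [:: inord 0; inord 1; inord 2].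

Definition inc (v : vertex m) : seq (edge m) :=
  match v with
  | inl a => map decode (nth [::] core_inc a)
  | inr (inl i) => [seq spoke i x | x <- ord3]
  | inr (inr (i, x)) =>
      [:: link (lift ord_max i) x; spoke i x; link (lift ord0 i) x]
  end.

End Graph.

Section GraphTheory.
Variable m : nat.
Hypothesis m_gt1 : 1 < m.

Implicit Types (i j : 'I_m) (x y : 'I_3).

Lemma coreE (a b : nat) : a < 50 -> b < 50 -> (core m a == core m b) = (a == b).
Proof.
by move=> aP bP; rewrite /core (inj_eq inl_inj) -val_eqE /= !inordK.
Qed.

Lemma core_val (a : 'I_50) : inl a = core m a.
Proof. by rewrite /core inord_val. Qed.

Lemma core_edge_val (e : 'I_72) : inl e = core_edge m e.
Proof. by rewrite /core_edge inord_val. Qed.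

(** A left inverse of [decode] on codes below 78; the value 78 marks edges without an end in the
    core. *)
Definition ecode (e : edge m) : nat :=
  match e with
  | inl e => e
  | inr (inl _) => 78
  | inr (inr (i, x)) =>
      if i == ord0 then 72 + x else if i == ord_max then 75 + x else 78
  end.

Lemma ord0_max : (ord_max : 'I_m.+1) == ord0 = false.
Proof. by rewrite -val_eqE /=; lia. Qed.

Lemma decodeK c : c < 78 -> ecode (decode m c) = c.
Proof.
move=> cP; rewrite /decode; case: ltnP => c72 /=; first by rewrite inordK.
case: ltnP => c75 /=; first by rewrite ?eqxx inordK; lia.
by rewrite ord0_max eqxx inordK; lia.
Qed.

Lemma decode_link0 x : decode m (72 + x) = link ord0 x.
Proof.
have x3 := ltn_ord x.
have h1 : (72 + x < 72) = false by lia.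
have h2 : 72 + x < 75 by lia.
by rewrite /decode h1 h2 addKn inord_val.
Qed.

Lemma decode_link_max x : decode m (75 + x) = link ord_max x.
Proof.
have x3 := ltn_ord x.
have h1 : (75 + x < 72) = false by lia.
have h2 : (75 + x < 75) = false by lia.
by rewrite /decode h1 h2 addKn inord_val.
Qed.

Lemma ecodeK e : ecode e < 78 -> decode m (ecode e) = e.
Proof.
case: e => [e|[[i x]|[i x]]] //=.
  by rewrite /decode ltn_ord -core_edge_val.
case: eqP => [->|_]; first by rewrite decode_link0.
by case: eqP => [->|] // _; rewrite decode_link_max.
Qed.

Lemma mem_map_decode e (s : seq nat) :
  all (gtn 78) s -> (e \in map (decode m) s) = (ecode e \in s).
Proof.
move/allP=> sP; apply/mapP/idP => [[c cs ->]|es].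
  by rewrite decodeK //; apply: sP.
by exists (ecode e) => //; rewrite ecodeK //; apply: sP.
Qed.

Lemma src_link0 x : src (link ord0 x : edge m) = core m (nth 0 left_ends x).
Proof. by rewrite /src /link unlift_none. Qed.

Lemma src_linkS j x : src (link (lift ord0 j) x) = rail j x.
Proof. by rewrite /src /link liftK. Qed.

Lemma tgt_link_max x :
  tgt (link ord_max x : edge m) = core m (nth 0 right_ends x).
Proof. by rewrite /tgt /link unlift_none. Qed.

Lemma tgt_link j x : tgt (link (lift ord_max j) x) = rail j x.
Proof. by rewrite /tgt /link liftK. Qed.

Lemma src_link_eq (j : 'I_m.+1) y i x :
  (src (link j y) == rail i x) = (link j y == link (lift ord0 i) x).
Proof.
rewrite [in RHS]/link !(inj_eq inr_inj) xpair_eqE.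
case: (unliftP ord0 j) => [k ->|->]; last by rewrite src_link0 (negPf (neq_lift _ _)).
by rewrite src_linkS /rail !(inj_eq inr_inj) xpair_eqE (inj_eq lift_inj).
Qed.

Lemma tgt_link_eq (j : 'I_m.+1) y i x :
  (tgt (link j y) == rail i x) = (link j y == link (lift ord_max i) x).
Proof.
rewrite [in RHS]/link !(inj_eq inr_inj) xpair_eqE.
case: (unliftP ord_max j) => [k ->|->].
  by rewrite tgt_link /rail !(inj_eq inr_inj) xpair_eqE (inj_eq lift_inj).
by rewrite tgt_link_max (negPf (neq_lift _ _)).
Qed.

Lemma mem_inc (v : vertex m) e :
  (e \in inc v) = (v \in ends (@src m) (@tgt m) e).
Proof.
rewrite !inE !(eq_sym v).
case: v => [a|[i|[i x]]] /=.
- have aP := ltn_ord a; rewrite mem_map_decode; last first.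
    by apply/allP => c /(core_inc_lt aP).
  rewrite core_val; case: e => [e|[[j y]|[j y]]].
  + by rewrite core_inc_edge //= !coreE // ?core_src_lt ?core_tgt_lt.
  + by apply/negP => /(core_inc_lt aP).
  rewrite [src _]/= [tgt _]/= [ecode _]/=.
  case: eqP => [->|/eqP nj0].
    rewrite core_inc_link0 // unlift_none coreE ?left_end_lt //.
    case: unliftP => [k|] // /eqP; first by rewrite orbF.
    by rewrite eq_sym ord0_max.
  case: unliftP nj0 => [k -> _|->]; last by rewrite eqxx.
  case: eqP => [->|/eqP nj].
    by rewrite core_inc_link_max // unlift_none coreE ?right_end_lt.
  case: unliftP nj => [l ->|->] //; last by rewrite eqxx.
  by move=> _; apply/negP => /(core_inc_lt aP).
- rewrite !inE; case: e => [e|[[j y]|[j y]]] //=.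
    rewrite orbF /spoke !(inj_eq inr_inj) !(inj_eq inl_inj) !xpair_eqE.
    case: eqP => //= _; rewrite -!val_eqE /= !inordK //.
    by case: y => -[|[|[]]].
  by case: unliftP => [k _|_]; case: unliftP.
rewrite !inE; case: e => [e|[[j y]|[j y]]] //.
  by rewrite /spoke /= /rail !(inj_eq inr_inj) !(inj_eq inl_inj) orbF.
have := src_link_eq j y i x; rewrite /link /rail => ->.
have := tgt_link_eq j y i x; rewrite /link /rail => ->.
by rewrite orbC.
Qed.

Lemma inc_uniq (v : vertex m) : uniq (inc v).
Proof.
case: v => [a|[i|[i x]]] /=.
- have aP := ltn_ord a; have [_ su _] := core_inc_spec aP.
  rewrite map_inj_in_uniq // => c d /(core_inc_lt aP) cP /(core_inc_lt aP) dP.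
  by move/(congr1 ecode); rewrite !decodeK.
- by rewrite !inE /spoke !(inj_eq inr_inj) !(inj_eq inl_inj) !xpair_eqE eqxx
    -!val_eqE /= !inordK.
by rewrite !inE !(inj_eq inr_inj) !xpair_eqE eqxx !andbT -val_eqE /= /bump
  leqNgt ltn_ord; lia.
Qed.

Lemma size_inc (v : vertex m) : size (inc v) = 3.
Proof.
by case: v => [a|[i|[i x]]] //=; rewrite size_map; case: (core_inc_spec (ltn_ord a)).
Qed.

Lemma src_neq_tgt (e : edge m) : src e != tgt e.
Proof.
case: e => [e|[[j y]|[j y]]] //=.
  rewrite coreE ?core_src_lt ?core_tgt_lt //.
  by apply: (@iota_all 72 (fun e => core_src e != core_tgt e)).
case: unliftP => [k ->|->]; case: unliftP => [l|] // E.
  rewrite /rail !(inj_eq inr_inj) xpair_eqE eqxx andbT -val_eqE.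
  by move/(congr1 (@nat_of_ord _)): E; rewrite lift0 lift_max /=; lia.
by move/eqP: E; rewrite eq_sym ord0_max.
Qed.

Lemma ecode_inc_core (e : edge m) a : a < 50 -> e \in inc (core m a) -> ecode e < 78.
Proof.
move=> aP; rewrite /= inordK // => /mapP[c /(core_inc_lt aP) cP ->].
by rewrite decodeK.
Qed.

Lemma link_in_core (j : 'I_m.+1) y a : a < 50 ->
  link j y \in inc (core m a) -> (j == ord0) || (j == ord_max).
Proof. by move=> aP /(ecode_inc_core aP) /=; do 2![case: eqP => //]. Qed.

(** As the chain is not empty, no link joins two core vertices; this tells links from core edges in
    [ends_inj]. *)
Lemma link_rail_end (j : 'I_m.+1) y :
  exists i x, rail i x \in ends (@src m) (@tgt m) (link j y).
Proof.
case: (unliftP ord0 j) => [k ->|->].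
  by exists k, y; rewrite !inE src_linkS eqxx.
case: (unliftP ord_max (ord0 : 'I_m.+1)) => [k ->|/eqP].
  by exists k, y; rewrite !inE tgt_link eqxx orbT.
by rewrite eq_sym ord0_max.
Qed.

Lemma mem_inc_hub (e : edge m) i : (e \in inc (hub i)) =
  [|| e == spoke i (inord 0), e == spoke i (inord 1) | e == spoke i (inord 2)].
Proof. by rewrite [LHS](mem_seq3 e). Qed.

Lemma mem_inc_rail (e : edge m) i x : (e \in inc (rail i x)) =
  [|| e == link (lift ord_max i) x, e == spoke i x | e == link (lift ord0 i) x].
Proof. by rewrite [LHS](mem_seq3 e). Qed.

(** An edge [f] with the ends of [e] occurs in the incidence lists of both ends of [e]. Comparing
    these lists leaves only [e]; between two core edges the table decides. *)
Lemma ends_inj : injective (ends (@src m) (@tgt m)).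
Proof.
move=> e f ef; apply/esym/eqP.
have: f \in inc (tgt e) by rewrite mem_inc -ef !inE eqxx orbT.
have: f \in inc (src e) by rewrite mem_inc -ef !inE eqxx.
case: e ef => [e|[[i x]|[j y]]] ef.
- move=> fs _; case: f fs ef => [f|[[i x]|[j y]]] fs ef.
  + move: ef; rewrite /ends /= => ef.
    have /allP/(_ (val e)) := core_ends_simple; rewrite mem_iota ltn_ord => /(_ isT).
    move=> /allP/(_ (val f)); rewrite mem_iota ltn_ord => /(_ isT).
    case/orP=> [/eqP/val_inj-> //|/negP[]].
    have := set22 (core m (core_src f)) (core m (core_tgt f)).
    have := set21 (core m (core_src f)) (core m (core_tgt f)).
    by rewrite -ef !inE !coreE ?core_src_lt ?core_tgt_lt ?ltn_ord // => -> ->.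
  + by have := ecode_inc_core (core_src_lt (ltn_ord e)) fs.
  + have [i [x]] := link_rail_end j y.
    by rewrite /link -ef !inE.
- rewrite [src _]/= [tgt _]/= (mem_inc_hub f i) (mem_inc_rail f i x).
  by case/or3P=> /eqP-> /or3P[]/eqP// ->; exact: eqxx.
have jE : inr (inr (j, y)) = link j y by [].
rewrite jE /src /tgt /link; case: (unliftP ord0 j) => [k jk|j0];
  case: (unliftP ord_max j) => [l jl|jm]; rewrite -/(link j y).
- have kl : l = k.+1 :> nat.
    by move: (congr1 (@nat_of_ord _) jl); rewrite jk lift0 lift_max.
  rewrite (mem_inc_rail f k y) (mem_inc_rail f l y) -jk -jl; case/or3P=> /eqP-> // /or3P[]//;
    rewrite !(inj_eq inr_inj) ?(inj_eq inl_inj) xpair_eqE => /andP[/eqP kl'] _.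
  + by exfalso; move: kl (congr1 (@nat_of_ord _) kl'); rewrite lift0 lift_max /=; lia.
  + by exfalso; move: kl; rewrite kl' /=; lia.
- rewrite (mem_inc_rail f k y) -jk => /or3P[]/eqP-> // ft.
    have /orP[/eqP k0|/eqP km] := link_in_core (right_end_lt y) ft.
      exfalso; move: (congr1 (@nat_of_ord _) jm) (congr1 (@nat_of_ord _) k0).
      by rewrite jk lift0 lift_max /=; lia.
    by have := neq_lift ord_max k; rewrite km eqxx.
  by have := ecode_inc_core (right_end_lt y) ft.
- rewrite (mem_inc_rail f l y) -jl => ft /or3P[]/eqP fE //; rewrite {}fE in ft *.
    by have := ecode_inc_core (left_end_lt y) ft.
  have /orP[/eqP k0|/eqP km] := link_in_core (left_end_lt y) ft.
    by have := neq_lift ord0 l; rewrite k0 eqxx.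
  exfalso; move: (congr1 (@nat_of_ord _) jl) (congr1 (@nat_of_ord _) km).
  by rewrite j0 lift0 lift_max /=; lia.
- by move/eqP: jm; rewrite j0 eq_sym ord0_max.
Qed.

End GraphTheory.

(** * Small cuts *)

Section Trie.
Variable A : eqType.

(** Keys are membership bits, values are profiles, so that a state reached along several branches of
    the sweep is stored once. *)
Inductive trie := Empty | Node of seq A & trie & trie.

Fixpoint find (bs : seq bool) (t : trie) : seq A :=
  match t, bs with
  | Empty, _ => [::]
  | Node s _ _, [::] => s
  | Node _ l r, b :: bs => find bs (if b then l else r)
  end.

Fixpoint insert (bs : seq bool) (a : A) (t : trie) : trie :=
  let: (s, l, r) := if t is Node s l r then (s, l, r) else ([::], Empty, Empty) in
  match bs with
  | [::] => Node (if a \in s then s else a :: s) l r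
  | true :: bs => Node s (insert bs a l) r
  | false :: bs => Node s l (insert bs a r)
  end.

Fixpoint elements (pre : seq bool) (t : trie) : seq (seq bool * A) :=
  if t is Node s l r then
    [seq (rev pre, a) | a <- s] ++
      (elements (true :: pre) l ++ elements (false :: pre) r)
  else [::].

Definition of_seq (s : seq (seq bool * A)) : trie :=
  foldr (fun x t => insert x.1 x.2 t) Empty s.

Lemma find_insert bs a t : a \in find bs (insert bs a t).
Proof.
elim: bs t => [|[] bs IH] [|s l r] //=; rewrite ?inE ?eqxx //.
by case: ifP => //; rewrite inE eqxx.
Qed.

Lemma insert_mono bs a bs' a' t :
  a \in find bs t -> a \in find bs (insert bs' a' t).
Proof.
elim: bs' bs t => [|[] bs' IH] [|[] bs] [|s l r] //=; try exact: IH.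
by case: ifP => // _; rewrite inE orbC => ->.
Qed.

Lemma find_of_seq bs a s : (bs, a) \in s -> a \in find bs (of_seq s).
Proof.
elim: s => //= -[bs' a'] s IH; rewrite inE => /orP[/eqP[-> ->]|/IH].
  exact: find_insert.
exact: insert_mono.
Qed.

Lemma mem_elements pre bs a t :
  a \in find bs t -> (rev pre ++ bs, a) \in elements pre t.
Proof.
elim: bs pre t => [|b bs IH] pre [|s l r] //=; rewrite !mem_cat.
  by move=> aS; rewrite cats0 map_f.
have -> : rev pre ++ b :: bs = rev (b :: pre) ++ bs.
  by rewrite rev_cons cat_rcons.
by case: b => /IH ->; rewrite !orbT.
Qed.

End Trie.

(* A state of a sweep over the vertices records, for a vertex set X, which of
   the vertices that still miss a neighbour lie in X, together with |X| (up to
   6), the size of the complement (up to 3) and the size of the cut. *)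
Definition profile := (nat * nat * nat)%type.
Definition state := (seq bool * profile)%type.

(** States with a cut above 5 are dropped, as [balanced] never asks for more than 6 edges. *)
Definition advance (xs : seq bool) (d : nat) (p : profile) : option profile :=
  let: (a, b, k) := p in
  if k + d <= 5 then
    Some (minn 6 (a + count id xs), minn 3 (b + count negb xs), k + d)
  else None.

Lemma advanceE xs d a b k : k + d <= 5 -> advance xs d (a, b, k) =
  Some (minn 6 (a + count id xs), minn 3 (b + count negb xs), k + d).
Proof. by rewrite /advance => ->. Qed.

Definition ndiff (xs ys : seq bool) : nat :=
  count id [seq p.1 != p.2 | p <- zip xs ys].

Definition earlier (v : nat) : seq nat :=
  [seq e.1 | e <- core_ends & e.2 == v].

(** The bits that survive the step: a vertex is remembered while it has a neighbour of larger number
    or one in the chain. *)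
Definition pending (v : nat) (live : seq nat) : bitseq :=
  [seq (w \in left_ends ++ right_ends) ||
    has (fun e => (e.1 == w) && (v < e.2)) core_ends | w <- v :: live].

Definition vertex_choice ps msk (s : state) (x : bool) : seq state :=
  if advance [:: x] (count (fun i => nth false s.1 i != x) ps) s.2 is Some p
  then [:: (mask msk (x :: s.1), p)] else [::].

Definition vertex_step (ps : seq nat) (msk : bitseq) (s : state) : seq state :=
  flatten [seq vertex_choice ps msk s x | x <- [:: true; false]].

Fixpoint core_sweep (v n : nat) (live : seq nat) (sts : seq state) :
    option (seq nat * seq state) :=
  if n is n'.+1 then
    if all (mem live) (earlier v) then
      let ps := [seq index w live | w <- earlier v] in
      let msk := pending v live in
      let T := foldr (fun s t => foldr (fun x t => insert x.1 x.2 t) t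
                      (vertex_step ps msk s)) (Empty _) sts in
      core_sweep v.+1 n' (mask msk (v :: live)) (elements [::] T)
    else None
  else Some (live, sts).

(** Bits are rearranged by attachment to the chain; 48 occurs twice, once for each end. *)
Definition core_states : seq state :=
  if core_sweep 0 50 [::] [:: ([::], (0, 0, 0))] is Some (live, sts) then
    [seq ([seq nth false s.1 (index w live) | w <- left_ends ++ right_ends], s.2)
    | s <- sts]
  else [::].

Definition quads : seq (seq bool) :=
  iter 4 (fun s => [seq b :: x | b <- [:: true; false], x <- s]) [:: [::]].

(** In a state of the chain the first three bits are the current ends of the rails, the last three
    the right attachments, which stay fixed until the chain is closed. The list [xs] begins with the
    hub. *)
Definition block_choice (s : state) (xs : seq bool) : seq state :=
  let rs := behead xs in
  if advance xs (ndiff (nseq 3 (head false xs)) rs + ndiff (take 3 s.1) rs) s.2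
    is Some p then [:: (rs ++ drop 3 s.1, p)] else [::].

Definition block_step (s : state) : seq state :=
  flatten [seq block_choice s xs | xs <- quads].

(** The clauses serve, in order, connectedness, cyclic connectivity together with the exclusion of
    3- and 4-cycles, and the exclusion of 5-cycles. *)
Definition balanced (a b k : nat) : bool :=
  [&& (k == 0) ==> (a == 0) || (b == 0),
      (2 < a) && (2 < b) ==> (4 < k) & (a == 5) && (2 < b) ==> (5 < k)].

Definition closing_ok (s : state) : bool :=
  let: (a, b, k) := s.2 in
  let k' := k + ndiff (take 3 s.1) (drop 3 s.1) in
  (5 < k') || balanced a b k'.

Definition grow (t : trie profile) : trie profile :=
  foldr (fun s t => foldr (fun x t => insert x.1 x.2 t) t (block_step s))
    (Empty _) (elements [::] t).

Definition merge (t u : trie profile) : trie profile :=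
  foldr (fun x t => insert x.1 x.2 t) u (elements [::] t).

(** The states after 3, 4, 5 and 6 blocks. That a further block leads to no new state is checked by
    [chain_invariant_ok]. *)
Definition chain_invariant : trie profile :=
  let t := iter 3 grow (of_seq core_states) in
  let t1 := grow t in let t2 := grow t1 in
  merge t (merge t1 (merge t2 (grow t2))).

Definition chain_invariant_ok (inv : trie profile) : bool :=
  all (fun s => closing_ok s &&
     all (fun x => x.2 \in find x.1 inv) (block_step s)) (elements [::] inv).

Lemma chain_invariantP : chain_invariant_ok chain_invariant.
Proof. by vm_compute. Qed.

Lemma foldr_insert_mono (x : seq (seq bool * profile)) bs p t :
  p \in find bs t ->
  p \in find bs (foldr (fun x t => insert x.1 x.2 t) t x).
Proof. by elim: x => //= y x IH pt; apply/insert_mono/IH. Qed.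

Lemma find_foldr_insert (x : seq (seq bool * profile)) bs p t :
  (bs, p) \in x -> p \in find bs (foldr (fun x t => insert x.1 x.2 t) t x).
Proof.
elim: x => //= -[bs' p'] x IH; rewrite inE => /orP[/eqP[-> ->]|/IH].
  exact: find_insert.
exact: insert_mono.
Qed.

Lemma mem_insert_all (f : state -> seq state) (sts : seq state) s x :
  s \in sts -> x \in f s ->
  x \in elements [::] (foldr (fun s t =>
    foldr (fun x t => insert x.1 x.2 t) t (f s)) (Empty _) sts).
Proof.
case: x => bs p ss xs; apply: (@mem_elements _ [::] bs p).
elim: sts ss => //= s' sts IH; rewrite inE => /orP[/eqP<-|/IH].
  exact: find_foldr_insert.
exact: foldr_insert_mono.
Qed.

Lemma chain_invariant_start x :
  x \in elements [::] (iter 3 grow (of_seq core_states)) ->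
  x.2 \in find x.1 chain_invariant.
Proof.
case: x => bs p xs; rewrite /chain_invariant /merge.
exact: find_foldr_insert.
Qed.

(** * Soundness of the sweep for a given vertex set *)

Section Sweep.
Variable inX : nat -> bool.

Definition cut_below v :=
  \sum_(e <- core_ends | e.2 < v) (inX e.1 != inX e.2 : nat).

Definition core_profile v : profile :=
  (minn 6 (count inX (iota 0 v)), minn 3 (count (predC inX) (iota 0 v)),
   cut_below v).

Lemma cut_belowS v : cut_below v.+1 =
  cut_below v + count (fun w => inX w != inX v) (earlier v).
Proof.
rewrite /cut_below (bigID (fun e : nat * nat => e.2 < v)) /=; congr (_ + _).
  by apply: eq_bigl => e; apply/andP/idP => [[]//|]; split=> //; lia.
rewrite (eq_bigl (fun e : nat * nat => e.2 == v)); last first.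
  by move=> e /=; rewrite ltnS -leqNgt -eqn_leq.
rewrite /earlier count_map -sum1_count big_filter_cond big_mkcondr /=.
by apply: eq_bigr => e /eqP ->; case: (_ != _).
Qed.

Lemma vertex_step_sound v live msk :
  all (mem live) (earlier v) -> cut_below v.+1 <= 5 ->
  (map inX (mask msk (v :: live)), core_profile v.+1) \in
    vertex_step [seq index w live | w <- earlier v] msk
      (map inX live, core_profile v).
Proof.
move=> /allP lv k5; apply/flatten_mapP; exists (inX v); first by case: (inX v).
have dE : count (fun i => nth false (map inX live) i != inX v)
    [seq index w live | w <- earlier v] =
    count (fun w => inX w != inX v) (earlier v).
  rewrite count_map; apply: eq_in_count => w wv /=.
  by rewrite (nth_map 0) ?index_mem ?nth_index //; apply: lv.
rewrite /vertex_choice [_.1]/= [_.2]/= dE {2}/core_profile /advance -cut_belowS.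
rewrite k5 mem_seq1 map_mask; apply/eqP; congr (_, (_, _, _)).
  by rewrite -[v.+1]addn1 iotaD count_cat /= add0n; lia.
by rewrite -[v.+1]addn1 iotaD count_cat /= add0n; lia.
Qed.

Lemma core_sweep_sound n v live sts live' sts' :
  core_sweep v n live sts = Some (live', sts') -> cut_below (v + n) <= 5 ->
  (map inX live, core_profile v) \in sts ->
  (map inX live', core_profile (v + n)) \in sts'.
Proof.
elim: n v live sts => [|n IH] v live sts /=; first by rewrite addn0 => -[<- <-].
case: ifP => // lv sE k5 ss; rewrite -addSnnS in k5 *; apply: (IH _ _ _ sE k5).
apply: mem_insert_all ss (vertex_step_sound _ lv _) => //.
(* [cut_below] is monotone, so the bound at the end of the sweep holds at this vertex too. *)
apply: (leq_trans _ k5); elim: n {sE IH k5} => [|n IH]; first by rewrite addn0.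
by rewrite addnS (cut_belowS (_ + _)); apply: leq_trans IH (leq_addr _ _).
Qed.

Definition core_cut := \sum_(e <- core_ends) (inX e.1 != inX e.2 : nat).

Lemma cut_below_core : cut_below 50 = core_cut.
Proof.
rewrite /cut_below big_mkcond; apply: eq_big_seq => e ee; rewrite ifT //.
by move: e ee; apply/allP; vm_compute.
Qed.

Lemma core_states_sound : core_cut <= 5 ->
  (map inX left_ends ++ map inX right_ends, core_profile 50) \in core_states.
Proof.
rewrite -cut_below_core => k5; rewrite /core_states.
(* Computation shows that the sweep does not fail and that the attachment vertices are all live at
   its end. *)
have /allP livE : all (mem (oapp fst [::] (core_sweep 0 50 [::] [:: ([::], (0, 0, 0))])))
   (left_ends ++ right_ends) by vm_compute.
case sE: core_sweep livE => [[live sts]|] livE; last first.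
  by have := livE 0 isT.
have := core_sweep_sound sE k5; rewrite add0n => /(_ _)/wrap[].
  by rewrite inE /core_profile /= /cut_below big1 //; move=> e; lia.
have F w : w \in left_ends ++ right_ends ->
    inX w = nth false (map inX live) (index w live).
  by move=> /livE lw; rewrite (nth_map 0) ?index_mem ?nth_index.
move=> ss; rewrite -map_cat; have /eq_in_map -> := F.
exact: (map_f (fun s : state =>
  ([seq nth false s.1 (index w live) | w <- left_ends ++ right_ends], s.2)) ss).
Qed.

Variables (hb : nat -> bool) (rb : nat -> nat -> bool).

Definition rails i := [:: rb i 0; rb i 1; rb i 2].
Definition before i := if i is j.+1 then rails j else map inX left_ends.

Definition block_cut i := ndiff (nseq 3 (hb i)) (rails i) + ndiff (before i) (rails i).

Definition chain_profile i : profile :=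
  (minn 6 (count inX (iota 0 50) + \sum_(j < i) count id (hb j :: rails j)),
   minn 3 (count (predC inX) (iota 0 50) + \sum_(j < i) count negb (hb j :: rails j)),
   core_cut + \sum_(j < i) block_cut j).

Definition chain_state i : state :=
  (before i ++ map inX right_ends, chain_profile i).

Lemma chain_state0 : core_cut <= 5 -> chain_state 0 \in core_states.
Proof.
move=> /core_states_sound; rewrite /chain_state /chain_profile /core_profile.
by rewrite !big_ord0 !addn0 cut_below_core.
Qed.

Lemma mem_quads a b c d : [:: a; b; c; d] \in quads.
Proof. by case: a; case: b; case: c; case: d. Qed.

Lemma block_step_sound i : core_cut + \sum_(j < i.+1) block_cut j <= 5 ->
  chain_state i.+1 \in block_step (chain_state i).
Proof.
move=> k5; apply/flatten_mapP.
exists (hb i :: rails i); first exact: mem_quads.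
have bE : take 3 (chain_state i).1 = before i.
  by rewrite /chain_state take_cat; case: i {k5} => [|i].
have cE : drop 3 (chain_state i).1 = map inX right_ends.
  by rewrite /chain_state drop_cat; case: i {k5 bE} => [|i].
rewrite /block_choice bE cE [behead _]/= [head _ _]/= -/(block_cut i).
rewrite /chain_state /chain_profile; set a0 := count inX _; set b0 := count _ _.
rewrite big_ord_recr /= addnA in k5; rewrite [X in advance _ _ X]/=.
rewrite advanceE // mem_seq1.
rewrite !big_ord_recr /=; apply/eqP; congr (_, (_, _, _)).
- by rewrite addnA; set u := a0 + _; lia.
- by rewrite addnA; set u := b0 + _; lia.
- by rewrite addnA.
Qed.

(* Stated for an arbitrary set of states, as unfolding the actual one would
   repeat the whole sweep. *)
Lemma chain_state_invariant inv i :
  chain_invariant_ok inv ->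
  (forall x, x \in elements [::] (iter 3 grow (of_seq core_states)) ->
     x.2 \in find x.1 inv) -> 2 < i ->
  core_cut + \sum_(j < i) block_cut j <= 5 ->
  chain_profile i \in find (chain_state i).1 inv.
Proof.
move=> inv_ok inv_start.
have mono j : core_cut + \sum_(l < j.+1) block_cut l <= 5 ->
    core_cut + \sum_(l < j) block_cut l <= 5.
  by rewrite big_ord_recr; apply: leq_trans; rewrite addnA leq_addr.
have grow_sound t j : core_cut + \sum_(l < j.+1) block_cut l <= 5 ->
    chain_state j \in elements [::] t ->
    chain_state j.+1 \in elements [::] (grow t).
  by move=> k5 jt; apply: mem_insert_all jt (block_step_sound k5).
elim: i => // i IH; rewrite leq_eqVlt => /orP[/eqP[<-]|i2] k5.
  have k4 := mono _ k5; have k3 := mono _ k4; have k0 := mono _ k3.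
  have s0 : chain_state 0 \in elements [::] (of_seq core_states).
    apply: (@mem_elements _ [::]); apply: find_of_seq; apply: chain_state0.
    by move: k0; rewrite big_ord0 addn0.
  have s3 := grow_sound _ _ k5 (grow_sound _ _ k4 (grow_sound _ _ k3 s0)).
  exact: inv_start s3.
have := IH i2 (mono _ k5) => iI.
have /allP/(_ (chain_state i)) := inv_ok.
rewrite (@mem_elements _ [::]) // => /(_ isT)/andP[_ /allP].
by move/(_ _ (block_step_sound k5)).
Qed.

(** The caps lie beyond every value that [balanced] tests for. *)
Lemma balanced_cap a b k : balanced (minn 6 a) (minn 3 b) k = balanced a b k.
Proof. by rewrite /balanced; lia. Qed.

Lemma cut_balanced_aux inv m : chain_invariant_ok inv ->
  (forall x, x \in elements [::] (iter 3 grow (of_seq core_states)) ->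
     x.2 \in find x.1 inv) -> 2 < m ->
  balanced (count inX (iota 0 50) + \sum_(j < m) count id (hb j :: rails j))
    (count (predC inX) (iota 0 50) + \sum_(j < m) count negb (hb j :: rails j))
    (core_cut + \sum_(j < m) block_cut j + ndiff (before m) (map inX right_ends)).
Proof.
move=> inv_ok inv_start m2; set a := count inX _ + _; set b := count _ _ + _; set k := _ + _.
(* A cut of at least 6 edges satisfies every clause. *)
have [k5|k5] := leqP k 5; last by rewrite /balanced; lia.
have k5' : core_cut + \sum_(j < m) block_cut j <= 5.
  by apply: leq_trans k5; rewrite leq_addr.
have := chain_state_invariant inv_ok inv_start m2 k5'.
have /allP/(_ (chain_state m)) := inv_ok.
move=> ok /(@mem_elements _ [::])/ok/andP[+ _].
have bE : take 3 (chain_state m).1 = before m.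
  by rewrite /chain_state take_cat; case: m {m2 a b k k5 k5' ok} => [|i].
have cE : drop 3 (chain_state m).1 = map inX right_ends.
  by rewrite /chain_state drop_cat; case: m {m2 a b k k5 k5' ok bE} => [|i].
rewrite /closing_ok bE cE [(chain_state m).2]/= /chain_profile -/a -/b -/k.
by rewrite ltnNge k5 /= balanced_cap.
Qed.

Lemma cut_balanced m : 2 < m ->
  balanced (count inX (iota 0 50) + \sum_(j < m) count id (hb j :: rails j))
    (count (predC inX) (iota 0 50) + \sum_(j < m) count negb (hb j :: rails j))
    (core_cut + \sum_(j < m) block_cut j + ndiff (before m) (map inX right_ends)).
Proof.
exact: (cut_balanced_aux chain_invariantP chain_invariant_start).
Qed.

End Sweep.

(** * Connectivity and girth from the bound on cuts *)

Section Cuts.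
Variable m : nat.
Hypothesis m_gt2 : 2 < m.
Let m_gt1 : 1 < m := ltnW m_gt2.

Definition graph : sgraph := igraph (src_neq_tgt m_gt1).

Implicit Type X : {set vertex m}.

Definition cut X : {set edge m} := [set e | (src e \in X) != (tgt e \in X)].

Definition core_in X a := core m a \in X.
(** Natural numbers as indices fit the sweep; the default [false] only concerns indices past the
    chain. *)
Definition hub_in X i := if insub i is Some j then hub j \in X else false.
Definition rail_in X i x :=
  if insub i is Some j then rail j (inord x) \in X else false.

Lemma hub_inE X (i : 'I_m) : hub_in X i = (hub i \in X).
Proof. by rewrite /hub_in valK. Qed.

Lemma rail_inE X (i : 'I_m) (x : 'I_3) : rail_in X i x = (rail i x \in X).
Proof. by rewrite /rail_in valK inord_val. Qed.

Lemma count_iota (P : pred nat) n : count P (iota 0 n) = \sum_(a < n) P a.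
Proof.
rewrite -sum1_count big_mkcond -(big_mkord xpredT (fun a => nat_of_bool (P a))).
by rewrite /index_iota subn0; apply: eq_bigr => a _; case: (P a).
Qed.

Lemma card_vertex_set (P : pred (vertex m)) : #|[set v | P v]| =
  \sum_(a < 50) P (core m a) + \sum_(i < m) (P (hub i) + \sum_(x < 3) P (rail i x)).
Proof.
rewrite -sum1_card big_mkcond big_sumType big_sumType /= big_split /=.
rewrite pair_bigA /=; congr (_ + (_ + _)).
- by apply: eq_bigr => a _; rewrite inE core_val; case: P.
- by apply: eq_bigr => a _; rewrite inE /hub; case: P.
- by apply: eq_bigr => -[a x] _; rewrite inE /rail; case: P.
Qed.

Lemma sum_pair n (F : 'I_n * 'I_3 -> nat) :
  \sum_p F p = \sum_i \sum_x F (i, x).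
Proof. by rewrite pair_bigA; apply: eq_bigr => -[]. Qed.

Lemma ndiffE xs ys : size xs = 3 -> size ys = 3 ->
  ndiff xs ys = \sum_(x < 3) (nth false xs x != nth false ys x).
Proof.
case: xs => [|x0 [|x1 [|x2 []]]] //; case: ys => [|y0 [|y1 [|y2 []]]] // _ _.
by rewrite /ndiff !big_ord_recl big_ord0 /=.
Qed.

Lemma src_linkE X (i : 'I_m.+1) (x : 'I_3) :
  (src (link i x) \in X) = nth false (before (core_in X) (rail_in X) i) x.
Proof.
case: (unliftP ord0 i) => [k ->|->].
  by rewrite src_linkS lift0 -rail_inE; case: x => -[|[|[]]].
by rewrite src_link0; case: x => -[|[|[]]].
Qed.

Lemma tgt_linkE X (i : 'I_m) (x : 'I_3) :
  (tgt (link (lift ord_max i) x) \in X) = nth false (rails (rail_in X) i) x.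
Proof. by rewrite tgt_link -rail_inE; case: x => -[|[|[]]]. Qed.

Lemma tgt_link_maxE X (x : 'I_3) :
  (tgt (link (ord_max : 'I_m.+1) x) \in X) =
  nth false (map (core_in X) right_ends) x.
Proof. by rewrite tgt_link_max; case: x => -[|[|[]]]. Qed.

Lemma size_before X i : size (before (core_in X) (rail_in X) i) = 3.
Proof. by case: i. Qed.

Lemma card_cut X : #|cut X| =
  core_cut (core_in X) + \sum_(j < m) block_cut (core_in X) (hub_in X) (rail_in X) j +
  ndiff (before (core_in X) (rail_in X) m) (map (core_in X) right_ends).
Proof.
rewrite -sum1_card big_mkcond big_sumType big_sumType /= -addnA; congr (_ + _).
  rewrite /core_cut (big_nth (0, 0)) big_mkord; apply: eq_bigr => e _.
  by rewrite inE /= /core_in /core_src /core_tgt; case: (_ != _).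
have eqb (e : edge m) : (if e \in cut X then 1 else 0) =
    ((src e \in X) != (tgt e \in X)) by rewrite inE; case: (_ != _).
rewrite !sum_pair.
(* The last link triple closes the chain; every other one is grouped with the spokes of the block
   that it enters. *)
rewrite [X in _ + X]big_ord_recr /= addnA; congr (_ + _).
  rewrite -big_split /=; apply: eq_bigr => i _.
  rewrite /block_cut !ndiffE ?size_before //; congr (_ + _); apply: eq_bigr => x _.
    by rewrite eqb /= -hub_inE -rail_inE; case: x => -[|[|[]]].
  have -> : widen_ord (leqnSn m) i = lift ord_max i.
    by apply: val_inj; rewrite [RHS]lift_max.
  by rewrite eqb src_linkE tgt_linkE lift_max.
rewrite ndiffE ?size_before //; apply: eq_bigr => x _.
by rewrite eqb src_linkE tgt_link_maxE.
Qed.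

Lemma cut_bound X : balanced #|X| #|~: X| #|cut X|.
Proof.
have -> : X = [set v | v \in X] by apply/setP => v; rewrite inE.
have -> : ~: [set v | v \in X] = [set v | v \notin X] by apply/setP => v; rewrite !inE.
rewrite !card_vertex_set card_cut.
have := cut_balanced (core_in X) (hub_in X) (rail_in X) m_gt2.
rewrite !count_iota; congr (is_true (balanced (_ + _) (_ + _) _)).
- by apply: eq_bigr => i _; rewrite /= hub_inE !big_ord_recl big_ord0 -!rail_inE.
- by apply: eq_bigr => i _; rewrite /= hub_inE !big_ord_recl big_ord0 -!rail_inE.
by have -> : [set v in X] = X by apply/setP => v; rewrite inE.
Qed.

Lemma graph_cubic : cubic graph.
Proof.
exact: igraph_cubic (ends_inj m_gt1) _ (mem_inc m_gt1) (inc_uniq m_gt1)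
  (@size_inc m).
Qed.

(** No edge leaves the component of [x], so the first clause of [balanced] makes its complement
    empty. *)
Lemma graph_connected : connected graph.
Proof.
move=> x y; pose X : {set vertex m} := [set z | connect (@adj graph) x z].
have cut0 : #|cut X| = 0.
  apply: eq_card0 => e; rewrite !inE; apply/negbF/eqP.
  have st := iadj_ends (@src m) (@tgt m) e.
  apply/idP/idP => xc; apply: connect_trans xc (connect1 _) => //.
  by rewrite adj_sym.
have /and3P[+ _ _] := cut_bound X; rewrite cut0 /= => /orP[]; rewrite cards_eq0.
  by move=> /eqP X0; have := in_set0 x; rewrite -X0 inE connect0.
by move=> /eqP X0; have := in_set0 y; rewrite -X0 !inE => /negbFE.
Qed.

(** The vertices reachable from [s] without [F] form a set whose cut lies in [F]. It contains [s]
    and misses [t], so the second clause of [balanced] applies. *)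
Lemma graph_cyclically_connected : cyclically_connected graph 5.
Proof.
move=> F FE F5 [s [t [[s3 /andP[_ us]] [t3 /andP[_ ut]] sep]]].
pose X : {set vertex m} := [set y | has (fun x => connect (del_edges F) x y) s].
have cutF : #|cut X| <= #|F|.
  rewrite -(card_imset _ (ends_inj m_gt1)); apply/subset_leq_card/subsetP => A.
  case/imsetP=> e eX ->; apply: contraLR eX => eF; rewrite !inE negbK.
  have st : del_edges F (src e : graph) (tgt e).
    by apply/andP; split=> //; apply: iadj_ends.
  have ts : del_edges F (tgt e : graph) (src e).
    by apply/andP; split; [rewrite adj_sym; apply: iadj_ends | rewrite setUC].
  apply/eqP; apply/idP/idP => /hasP[x xs xe]; apply/hasP; exists x => //.
    exact: connect_trans xe (connect1 st).
  exact: connect_trans xe (connect1 ts).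
have sX : 2 < #|X|.
  apply: leq_trans s3 _; rewrite -(card_uniqP us); apply/subset_leq_card/subsetP.
  by move=> x xs; rewrite inE; apply/hasP; exists x; rewrite ?connect0.
have tX : 2 < #|~: X|.
  apply: leq_trans t3 _; rewrite -(card_uniqP ut); apply/subset_leq_card/subsetP.
  move=> y yt; rewrite !inE; apply/hasPn => x xs; exact: sep.
by have /and3P[_ + _] := cut_bound X; rewrite sX tX => /leq_trans/(_ cutF);
  rewrite leqNgt F5.
Qed.

(** A cut edge is charged to its end on the cycle. Two edges charged to one vertex would, with its
    two cycle edges, give it degree 4. *)
Lemma cycle_cut (s : seq graph) : graph_cycle s ->
  #|cut [set v in s]| <= size s.
Proof.
case=> s3 /andP[cs us]; rewrite -(card_uniqP us).
pose f (e : edge m) : graph := if src e \in s then src e else tgt e.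
rewrite -(card_in_imset (f := f)); last first.
  move=> e1 e2; rewrite !inE => c1 c2 eqf.
  pose g (e : edge m) := if src e \in s then tgt e else src e.
  have fg e : ends (@src m) (@tgt m) e = [set f e; g e].
    by rewrite /ends /f /g; case: ifP => // _; rewrite setUC.
  have fs e : (src e \in s) != (tgt e \in s) -> f e \in s /\ g e \notin s.
    by rewrite /f /g; case: ifP => h; rewrite ?h //=; case: (_ \in s).
  have [v1 g1] := fs _ c1; have [_ g2] := fs _ c2.
  (* After rotation the cycle starts at [f e1], whose neighbours on it are the second vertex [a] and
     the last vertex [z], distinct as the length is at least 3. *)
  have [i p pE] := rot_to v1.
  have up : uniq (f e1 :: p) by rewrite -pE rot_uniq.
  have cp : cycle (@adj graph) (f e1 :: p) by rewrite -pE rot_cycle.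
  have sp w : w \in f e1 :: p -> w \in s by rewrite -pE mem_rot.
  have szp : size (f e1 :: p) = size s by rewrite -pE size_rot.
  case: p pE up cp sp szp => [|a [|b p]] pE up cp sp szp.
  - by move: s3; rewrite -szp.
  - by move: s3; rewrite -szp.
  move: cp; rewrite /= rcons_path => /and3P[/iadjP[ea eaE] _ /andP[_ /iadjP[eb ebE]]].
  set z := last b p in ebE.
  have nza : a != z.
    by move: up; rewrite /= => /and3P[_ + _]; apply: contra => /eqP->; apply: mem_last.
  have za : z \in s by apply: sp; rewrite inE orbC [_ \in a :: _]inE [z \in _]mem_last orbT.
  have aa : a \in s by apply: sp; rewrite !inE eqxx orbT.
  apply/eqP; apply: contraT => n12.
  have := @size_inc m (f e1); have := inc_uniq m_gt1 (f e1) => ui szi.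
  have : uniq [:: ea; eb; e1; e2].
    have opp e e' w w' : ends (@src m) (@tgt m) e = [set f e1; w] ->
        ends (@src m) (@tgt m) e' = [set f e1; w'] -> w != w' -> e != e'.
      move=> eE eE' nw; apply: contra nw => /eqP ee'; apply/eqP.
      rewrite -(opposite_eq (src_neq_tgt m_gt1) eE).
      by rewrite ee' (opposite_eq (src_neq_tgt m_gt1) eE').
    have neq w w' : w \in s -> w' \notin s -> w != w'.
      by move=> ws; apply: contra => /eqP<-.
    have fg2 := fg e2; rewrite -eqf in fg2.
    rewrite setUC in ebE.
    rewrite /= !inE !negb_or (opp _ _ _ _ eaE ebE nza) n12 andbT.
    rewrite (opp _ _ _ _ eaE (fg e1)) ?neq // (opp _ _ _ _ eaE fg2) ?neq //.
    by rewrite (opp _ _ _ _ ebE (fg e1)) ?neq // (opp _ _ _ _ ebE fg2) ?neq.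
  move=> u4; suff: size [:: ea; eb; e1; e2] <= size (inc (f e1)) by rewrite szi.
  apply: uniq_leq_size u4 _ => e.
  rewrite mem_inc // !inE => /or4P[]/eqP->.
  - by have := set21 (f e1) a; rewrite -eaE !inE.
  - by have := set22 z (f e1); rewrite -ebE !inE.
  - by have := set21 (f e1) (g e1); rewrite -fg !inE.
  - by have := set21 (f e2) (g e2); rewrite -fg -eqf !inE.
apply/subset_leq_card/subsetP => v /imsetP[e]; rewrite !inE => + ->.
by rewrite /f; case: ifP => h; rewrite ?h //=; case: (_ \in s).
Qed.

Lemma graph_girth_ge6 (s : seq graph) : graph_cycle s -> 6 <= size s.
Proof.
move=> sC; have [s3 /andP[_ us]] := sC; rewrite leqNgt; apply/negP => s6.
have cs : #|[set v in s]| = size s by rewrite cardsE; apply/card_uniqP.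
have ct : 2 < #|~: [set v in s]|.
  by move: (cardsC [set v in s]); rewrite cs card_vertex; move: m_gt2 s6; lia.
have := cycle_cut sC; have := cut_bound [set v in s]; rewrite cs.
by rewrite /balanced ct; move: s3 s6; lia.
Qed.

Lemma graph_girth : has_girth graph 6.
Proof.
split=> [|s]; last exact: graph_girth_ge6.
exists (map (core m) [:: 45; 41; 43; 46; 42; 44]) => //; split=> //.
have adjE e a b : e < 72 -> nth (0, 0) core_ends e \in [:: (a, b); (b, a)] ->
    @adj graph (core m a) (core m b).
  move=> eP eE; apply/iadjP; exists (core_edge m e).
  rewrite /ends /= inordK // /core_src /core_tgt; move: eE; rewrite !inE.
  by case/orP=> /eqP-> //=; rewrite setUC.
apply/andP; split.
  (* The numbers are the positions of the hexagon edges in [core_ends]. *)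
  apply/andP; split; first exact: (adjE 64).
  apply/andP; split; first exact: (adjE 61).
  apply/andP; split; first exact: (adjE 67).
  apply/andP; split; first exact: (adjE 66).
  apply/andP; split; first exact: (adjE 63).
  by apply/andP; split; first exact: (adjE 65).
rewrite map_inj_in_uniq // => a b aS bS /eqP; rewrite coreE => [/eqP//||].
  by move: a aS {bS}; apply/allP.
by move: b bS {aS}; apply/allP.
Qed.

End Cuts.

(** * Uncolourability *)

Definition colours : seq nat := [:: 0; 1; 2].

Fixpoint words (n : nat) : seq (seq nat) :=
  if n is n'.+1 then [seq a :: w | a <- colours, w <- words n'] else [:: [::]].

Lemma mem_words (s : seq nat) : all (gtn 3) s -> s \in words (size s).
Proof.
elim: s => // a s IH /andP[a3 /IH sS].
suff aC : a \in colours by apply: (allpairs_f cons aC sS).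
by case: a a3 => [|[|[]]].
Qed.

Definition transition (s h t : seq nat) : bool :=
  [&& uniq h, uniq [:: nth 0 s 0; nth 0 h 0; nth 0 t 0],
      uniq [:: nth 0 s 1; nth 0 h 1; nth 0 t 1] &
      uniq [:: nth 0 s 2; nth 0 h 2; nth 0 t 2]].

(* Of three link colours this remembers which one is repeated and which one is
   not, or the sign of the permutation if they are all different.  Two
   consecutive blocks preserve it. *)
Definition kind (s : seq nat) : nat :=
  let: x := nth 0 s 0 in let: y := nth 0 s 1 in let: z := nth 0 s 2 in
  if x == y then 3 * z + x else if y == z then 3 * x + y
  else if x == z then 3 * y + x else 9 + (y + 3 - x) %% 3.

Lemma transition2_kind s h r h' t :
  size s = 3 -> size h = 3 -> size r = 3 -> size h' = 3 -> size t = 3 ->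
  all (gtn 3) (s ++ h ++ r ++ h' ++ t) ->
  transition s h r -> transition r h' t -> kind s = kind t.
Proof.
move=> s3 h3 r3 h'3 t3; rewrite !all_cat => /and5P[sc hc rc h'c tc] shr rht.
(* The guards discard improper words early and so prune the enumeration of $27^5$ tuples. *)
have: all (fun s => all (fun h => if ~~ uniq h then true else
    all (fun r => if ~~ transition s h r then true else
    all (fun h' => if ~~ uniq h' then true else
    all (fun t => if ~~ transition r h' t then true else kind s == kind t)
      (words 3)) (words 3)) (words 3)) (words 3)) (words 3) by vm_compute.
move/allP/(_ s); rewrite -[in X in _ \in X]s3 mem_words // => /(_ isT).
move/allP/(_ h); rewrite -[in X in _ \in X]h3 mem_words // => /(_ isT).
case/andP: (shr) => -> _ /allP/(_ r); rewrite -[in X in _ \in X]r3 mem_words //.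
move=> /(_ isT); rewrite shr => /allP/(_ h').
rewrite -[in X in _ \in X]h'3 mem_words // => /(_ isT).
case/andP: (rht) => -> _ /allP/(_ t); rewrite -[in X in _ \in X]t3 mem_words //.
by move=> /(_ isT); rewrite rht => /eqP.
Qed.

(* l and r are the colours at the ends of the chain of a pole, hs those at the
   vertex h0 and e the colour of the edge from c0 to the hexagon. *)
Lemma pole_ends_differ l r hs e : size l = 3 -> size r = 3 -> size hs = 3 ->
  all (gtn 3) (l ++ r ++ hs) -> e < 3 -> kind l = kind r -> uniq hs ->
  uniq [:: nth 0 hs 0; nth 0 l 1; nth 0 r 2] ->
  uniq [:: nth 0 hs 1; nth 0 l 2; e] -> nth 0 r 1 != e.
Proof.
move=> l3 r3 hs3; rewrite !all_cat => /and3P[lc rc hc] e3 klr u1 u2 u3.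
have: all (fun l => all (fun r => if kind l != kind r then true else
    all (fun hs => if ~~ uniq hs then true else
      if ~~ uniq [:: nth 0 hs 0; nth 0 l 1; nth 0 r 2] then true else
    all (fun e => if ~~ uniq [:: nth 0 hs 1; nth 0 l 2; e] then true
      else nth 0 r 1 != e) colours) (words 3)) (words 3)) (words 3).
  by vm_compute.
move/allP/(_ l); rewrite -[in X in _ \in X]l3 mem_words // => /(_ isT).
move/allP/(_ r); rewrite -[in X in _ \in X]r3 mem_words // => /(_ isT).
rewrite klr eqxx => /allP/(_ hs); rewrite -[in X in _ \in X]hs3 mem_words //.
move=> /(_ isT); rewrite u1 u2 => /allP/(_ e); rewrite u3; apply.
by case: e e3 {u3} => [|[|[]]].
Qed.

Lemma third_colour a b o : all (gtn 3) [:: a; b; o] -> uniq [:: a; b; o] ->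
  a != b /\ o = 3 - (a + b).
Proof. by rewrite /= !inE; lia. Qed.

(** The edges [r0] to [r5] run round the hexagon, and each dangling edge, lying between two
    consecutive ones, has the third colour. So it is enough to enumerate the $3^6$ words for the
    hexagon. *)
Lemma hexagon_parity r0 r1 r2 r3 r4 r5 o0 o1 o2 o3 o4 o5 :
  all (gtn 3) [:: r0; r1; r2; r3; r4; r5] ->
  all (gtn 3) [:: o0; o1; o2; o3; o4; o5] ->
  uniq [:: r5; r0; o0] -> uniq [:: r0; r1; o1] -> uniq [:: r1; r2; o2] ->
  uniq [:: r2; r3; o3] -> uniq [:: r3; r4; o4] -> uniq [:: r4; r5; o5] ->
  o3 != o0 -> o4 != o1 -> o5 != o2 -> False.
Proof.
move=> rc oc u0 u1 u2 u3 u4 u5.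
have: all (fun r => let c := nth 0 r in let o i j := 3 - (c i + c j) in
    ~~ [&& c 5 != c 0, c 0 != c 1, c 1 != c 2, c 2 != c 3, c 3 != c 4, c 4 != c 5,
      o 2 3 != o 5 0, o 3 4 != o 0 1 & o 4 5 != o 1 2]) (words 6) by vm_compute.
move/allP/(_ _ (mem_words rc)) => /=.
have T a b o : all (gtn 3) [:: a; b; o] -> uniq [:: a; b; o] ->
  a != b /\ o = 3 - (a + b) by exact: third_colour.
move: rc oc => /= /and5P[c0 c1 c2 c3 /and3P[c4 c5 _]].
move=> /and5P[d0 d1 d2 d3 /and3P[d4 d5 _]].
have [|-> ->] := T _ _ _ _ u0; first by rewrite /= c5 c0 d0.
have [|-> ->] := T _ _ _ _ u1; first by rewrite /= c0 c1 d1.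
have [|-> ->] := T _ _ _ _ u2; first by rewrite /= c1 c2 d2.
have [|-> ->] := T _ _ _ _ u3; first by rewrite /= c2 c3 d3.
have [|-> ->] := T _ _ _ _ u4; first by rewrite /= c3 c4 d4.
have [|-> ->] := T _ _ _ _ u5; first by rewrite /= c4 c5 d5.
by move=> h n1 n2 n3; move: h; rewrite n1 n2 n3.
Qed.

Section Core.
Variable c : nat -> nat.
Hypothesis c_proper : forall a, 1 < a -> a < 50 ->
  all (gtn 3) (map c (nth [::] core_inc a)) && uniq (map c (nth [::] core_inc a)).

(** A decidable test on codes, so that [isT] proves each concrete instance. The vertices 0 and 1 are
    excluded because [c_proper] is silent about them. *)
Definition is_corner (s : seq nat) :=
  has (fun a => (1 < a) && perm_eq s (nth [::] core_inc a)) (iota 0 50).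

Lemma corner (s : seq nat) : is_corner s ->
  all (gtn 3) (map c s) && uniq (map c s).
Proof.
case/hasP=> a; rewrite mem_iota => /andP[_ a50] /andP[a1 sa].
have /andP[ca ua] := c_proper a1 a50.
by rewrite (perm_uniq (perm_map c sa)) ua (eq_all_r (perm_mem (perm_map c sa))) ca.
Qed.

Lemma small_colour e :
  has (fun a => (1 < a) && (e \in nth [::] core_inc a)) (iota 0 50) -> c e < 3.
Proof.
case/hasP=> a; rewrite mem_iota => /andP[_ a50] /andP[a1 ea].
by have /andP[/allP ca _] := c_proper a1 a50; apply: ca; apply: map_f.
Qed.

Definition is_transition (s h t : seq nat) :=
  [&& size s == 3, size h == 3, size t == 3, is_corner h,
      is_corner [:: nth 0 s 0; nth 0 h 0; nth 0 t 0],
      is_corner [:: nth 0 s 1; nth 0 h 1; nth 0 t 1] &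
      is_corner [:: nth 0 s 2; nth 0 h 2; nth 0 t 2]].

Lemma corner_transition s h t : is_transition s h t ->
  [/\ all (gtn 3) (map c (s ++ h ++ t)), size s = 3, size h = 3, size t = 3 &
   transition (map c s) (map c h) (map c t)].
Proof.
case: s => [|s0 [|s1 [|s2 []]]] //; case: h => [|h0 [|h1 [|h2 []]]] //.
case: t => [|t0 [|t1 [|t2 []]]] //.
case/and5P=> _ _ _ /corner/andP[H1 U1] /and3P[/corner/andP[H2 U2]].
move=> /corner/andP[H3 U3] /corner/andP[H4 U4].
split=> //; last by apply/and4P; split.
case/and4P: H1 => /= -> -> -> _; case/and4P: H2 => /= -> _ -> _.
by case/and4P: H3 => /= -> _ -> _; case/and4P: H4 => /= -> _ -> _.
Qed.

(** A short pole: the link triples [s0] to [s4] alternate with the spokes of four blocks, [hs] lies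
    at the hub of the damaged block, and [e] leads to the hexagon. *)
Definition is_pole (s0 h0 s1 h1 s2 h2 s3 h3 s4 hs : seq nat) (e : nat) :=
  [&& is_transition s0 h0 s1, is_transition s1 h1 s2, is_transition s2 h2 s3,
      is_transition s3 h3 s4, (size hs == 3) && is_corner hs,
      is_corner [:: nth 0 hs 0; nth 0 s0 1; nth 0 s4 2] &
      is_corner [:: nth 0 hs 1; nth 0 s0 2; e]].

(** Four blocks preserve the kind, two at a time, so [pole_ends_differ] applies. *)
Lemma core_pole s0 h0 s1 h1 s2 h2 s3 h3 s4 hs e :
  is_pole s0 h0 s1 h1 s2 h2 s3 h3 s4 hs e -> c (nth 0 s4 1) != c e.
Proof.
case/and5P=> /corner_transition[a1 z1 y1 _ t1] /corner_transition[a2 z2 y2 _ t2].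
case/corner_transition=> [a3 z3 y3 _ t3] /corner_transition[a4 z4 y4 z5 t4].
case/and3P=> /andP[/eqP zh /corner/andP[ch uh]].
move=> /corner/andP[_ u1] /corner/andP[ce u2].
have k4 : kind (map c s0) = kind (map c s4).
  move: a1 a2 a3 a4; rewrite !map_cat !all_cat.
  case/and3P=> S0 H0 _ /and3P[S1 H1 _] /and3P[S2 H2 _] /and3P[S3 H3 S4].
  transitivity (kind (map c s2)).
    by apply: (transition2_kind _ _ _ _ _ _ t1 t2);
      rewrite ?size_map // !all_cat S0 H0 S1 H1.
  by apply: (transition2_kind _ _ _ _ _ _ t3 t4);
    rewrite ?size_map // !all_cat S2 H2 S3 H3.
have -> : c (nth 0 s4 1) = nth 0 (map c s4) 1 by rewrite (nth_map 0) ?z5.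
apply: (@pole_ends_differ (map c s0) _ (map c hs)); rewrite ?size_map //.
- rewrite map_cat all_cat in a1; rewrite !map_cat !all_cat in a4.
  case/andP: a1 => a1 _; case/and3P: a4 => _ _ a4.
  by rewrite !all_cat a1 a4 ch.
- by case/and3P: ce => _ _ /andP[].
- by rewrite !(nth_map 0) ?zh ?z1 ?z5.
- by rewrite !(nth_map 0) ?zh ?z1 ?z5.
Qed.

(** The codes 72 and 75 belong to the vertices 0 and 1, so [c_proper] does not bound their
    colours. *)
Lemma core_uncolourable : c 72 < 3 -> c 75 < 3 ->
  kind (map c [:: 72; 73; 74]) <> kind (map c [:: 75; 76; 77]).
Proof.
move=> c72 c75 k0.
(* The short poles are given by their codes in [n1] and [n2]; in [n0] the hypothesis [k0] stands for
   the chain of the long pole. *)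
have n1 : c 59 != c 58 := @core_pole [:: 3; 5; 7] [:: 4; 6; 8] [:: 9; 11; 13]
  [:: 10; 12; 14] [:: 15; 17; 19] [:: 16; 18; 20] [:: 22; 24; 27]
  [:: 23; 25; 28] [:: 21; 59; 26] [:: 1; 2; 0] 58 isT.
have n2 : c 62 != c 60 := @core_pole [:: 32; 34; 36] [:: 33; 35; 37]
  [:: 38; 40; 42] [:: 39; 41; 43] [:: 44; 46; 48] [:: 45; 47; 49]
  [:: 51; 53; 56] [:: 52; 54; 57] [:: 50; 62; 55] [:: 30; 31; 29] 60 isT.
have n0 : c 76 != c 70.
  have /andP[h hu] := @corner [:: 69; 71; 68] isT.
  have /andP[h1 u1] := @corner [:: 69; 73; 77] isT.
  have /andP[h2 u2] := @corner [:: 71; 74; 70] isT.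
  apply: (@pole_ends_differ _ (map c [:: 75; 76; 77]) (map c [:: 69; 71; 68]) _
    _ _ _ _ _ k0) => //; last by case/and4P: h2.
  case/and4P: h1 => _ c73 c77 _; case/and4P: h2 => _ c74 _ _.
  by rewrite !all_cat h /= c72 c75 !small_colour.
(* The corners of the hexagon in cyclic order, each with its two hexagon edges followed by the
   dangling one. *)
have /andP[h0 u0] := @corner [:: 65; 64; 70] isT.
have /andP[h1 u1] := @corner [:: 64; 61; 58] isT.
have /andP[h2 u2] := @corner [:: 61; 67; 60] isT.
have /andP[h3 u3] := @corner [:: 67; 66; 76] isT.
have /andP[h4 u4] := @corner [:: 66; 63; 59] isT.
have /andP[h5 u5] := @corner [:: 63; 65; 62] isT.
apply: (hexagon_parity _ _ u0 u1 u2 u3 u4 u5) => //=.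
  by rewrite !small_colour.
by rewrite !small_colour.
Qed.

End Core.

Section Uncolourable.
Variable m : nat.
Hypotheses (m_gt2 : 2 < m) (m_even : ~~ odd m).
Let m_gt1 : 1 < m := ltnW m_gt2.

Definition hubs_apart : {set vertex m} := ~: [set core m 0; core m 1].

Lemma core_apart a : a < 50 -> (core m a \in hubs_apart) = (1 < a).
Proof. by move=> aP; rewrite !inE !coreE //; case: a aP => [|[]]. Qed.

Definition apart_codes := nth [::] core_inc 0 ++ nth [::] core_inc 1.

Lemma dangling_code (e : edge m) : ~~ (ends (@src m) (@tgt m) e \subset hubs_apart) ->
  ecode e \in apart_codes.
Proof.
case/subsetPn=> v; rewrite -(mem_inc m_gt1) => ev.
rewrite in_setC in_set2 negbK /apart_codes mem_cat.
case/orP=> /eqP vE; move: ev; rewrite vE [inc _]/= inordK // mem_map_decode // => -> //.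
by rewrite orbT.
Qed.

(** Prepares [colouring_on_extend]: no remaining vertex is adjacent to both 0 and 1. *)
Lemma few_dangling v : v \in hubs_apart ->
  count (fun e => ~~ (ends (@src m) (@tgt m) e \subset hubs_apart)) (inc v) <= 1.
Proof.
move=> vS; apply: leq_trans (sub_count dangling_code _) _.
pose d (e : edge m) := ecode e \in apart_codes; rewrite -[count _ _]/(count d _).
case: v vS => [a|[i|[i x]]] vS.
- have aP := ltn_ord a; rewrite core_val core_apart // in vS.
  rewrite [inc _]/= count_map.
  have -> : count (preim (decode m) d) (nth [::] core_inc a) =
      count (mem apart_codes) (nth [::] core_inc a).
    by apply: eq_in_count => c /(core_inc_lt aP) cP; rewrite /= /d decodeK.
  suff : (1 < a) ==> (count (mem apart_codes) (nth [::] core_inc a) <= 1).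
    by rewrite vS.
  by move: (val a) aP; apply: iota_all; vm_compute.
- rewrite [inc _]/= (eq_in_count (a2 := pred0)) ?count_pred0 // => e.
  by rewrite !inE => /or3P[]/eqP->.
have -> : count d (inc (rail i x)) =
  d (link (lift ord_max i) x) + (d (spoke i x) + (d (link (lift ord0 i) x) + 0)) by [].
have nd e : d e -> ecode e < 78.
  by rewrite /d /apart_codes mem_cat => /orP[]; apply: core_inc_lt.
have dS : d (spoke i x) = false by apply/negP => /nd.
have dl j : d (link j x) -> (j == ord0) || (j == ord_max).
  by move/nd => /=; do 2!case: eqP.
rewrite dS add0n addn0; case dm: (d (link (lift ord_max i) x)); last by case: (d _).
case d0: (d (link (lift ord0 i) x)) => //.
(* Both links of a rail vertex reach the core only in a block that is first and last at once, which
   [m_gt1] excludes. *)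
have := dl _ dm; rewrite orbC eq_sym (negPf (neq_lift _ _)) => /eqP i0.
have := dl _ d0; rewrite eq_sym (negPf (neq_lift _ _)) => /eqP im.
move: (congr1 (@nat_of_ord _) i0) (congr1 (@nat_of_ord _) im).
by rewrite lift0 lift_max /= => ->; move: m_gt1; lia.
Qed.

(** Refutes both a 3-edge-colouring of the whole graph and bicriticality. *)
Lemma not_colourable_apart :
  ~ exists c, @colouring_on (graph m_gt2) 3 hubs_apart c.
Proof.
case=> c /(colouring_on_extend (ends_inj m_gt1)
  (mem_inc m_gt1) (inc_uniq m_gt1) (@size_inc m))/(_ few_dangling)[g g3 gu].
pose gc a := g (decode m a).
have proper a : 1 < a -> a < 50 -> all (gtn 3) (map gc (nth [::] core_inc a)) &&
    uniq (map gc (nth [::] core_inc a)).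
  move=> a1 a50; have aS : core m a \in hubs_apart by rewrite core_apart.
  have := g3 _ aS; have := gu _ aS.
  rewrite [inc _]/= inordK // => ua ca.
  have -> : map gc (nth [::] core_inc a) = map g (map (decode m) (nth [::] core_inc a)).
    by rewrite -map_comp.
  by rewrite ua andbT all_map.
pose link' (k : nat) (x : 'I_3) : edge m := link (inord k) x.
pose L k := [seq g (link' k x) | x <- ord3].
have railS (i : 'I_m) x : rail i x \in hubs_apart by rewrite !inE.
have hubS (i : 'I_m) : hub i \in hubs_apart by rewrite !inE.
have lift_inord (i : 'I_m) : (lift ord_max i = inord i) * (lift ord0 i = inord i.+1).
  by have im := ltn_ord i; split; apply: ord_inj; rewrite inordK ?lift_max ?lift0 // ltnS ltnW.
have step k (km : k < m) : exists h, [/\ size h = 3,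
    all (gtn 3) (L k ++ h ++ L k.+1) & transition (L k) h (L k.+1)].
  pose i := Ordinal km; exists [seq g (spoke i x) | x <- ord3].
  have rp x : [&& g (link' k x) < 3, g (spoke i x) < 3, g (link' k.+1 x) < 3 &
      uniq [:: g (link' k x); g (spoke i x); g (link' k.+1 x)]].
    have := gu _ (railS i x); have := g3 _ (railS i x).
    by rewrite /= !lift_inord => /and4P[-> -> ->].
  split=> //.
    rewrite !all_cat /= !andbT.
    by case/and4P: (rp (inord 0)) => -> -> -> _; case/and4P: (rp (inord 1)) => -> -> -> _;
       case/and4P: (rp (inord 2)) => -> -> -> _.
  apply/and4P; split; first exact: (gu _ (hubS i)).
  - by case/and4P: (rp (inord 0)).
  - by case/and4P: (rp (inord 1)).
  - by case/and4P: (rp (inord 2)).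
(* Blocks are passed in pairs; here the parity of [m] enters. *)
have kL k : k.*2 <= m -> kind (L 0) = kind (L k.*2).
  elim: k => // k IH km; rewrite IH; last by move: km; rewrite doubleS; lia.
  have [|h [h3 hc ht]] := step k.*2; first by move: km; rewrite doubleS; lia.
  have [|h' [h'3 h'c h't]] := step k.*2.+1; first by move: km; rewrite doubleS; lia.
  apply: (transition2_kind _ h3 _ h'3 _ _ ht h't) => //.
  by move: hc h'c; rewrite !all_cat => /and3P[-> -> _] /and3P[-> -> ->].
have Lm := kL m./2; rewrite even_halfK // leqnn in Lm.
have L0E : L 0 = map gc [:: 72; 73; 74].
  rewrite /L /gc /link' /= /decode /= (_ : inord 0 = ord0) //.
  by apply: val_inj; rewrite /= inordK.
have LmE : L m = map gc [:: 75; 76; 77].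
  rewrite /L /gc /link' /= /decode /= (_ : inord m = ord_max) //.
  by apply: val_inj; rewrite /= inordK.
(* The first and the last block bound the colours of the codes 72 and 75. *)
have [|h [_ h0 _]] := step 0; first by lia.
have [|h' [_ hm _]] := step m.-1; first by lia.
rewrite prednK in hm; last by lia.
apply: (core_uncolourable proper).
- by move: h0; rewrite L0E !all_cat => /andP[/and4P[]].
- by move: hm; rewrite LmE !all_cat => /and3P[_ _ /and4P[]].
by rewrite -L0E -LmE; apply: Lm.
Qed.

End Uncolourable.

(** * Colourings after removing two adjacent vertices *)

(* A mask lists the removed vertices of a block: 0 for its hub, x + 1 for its
   vertex on rail x. *)
Definition block_ok (k : nat) (mask s h t : seq nat) : bool :=
  [&& all (fun x => [&& nth 0 s x < k, nth 0 h x < k & nth 0 t x < k]) (iota 0 3),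
      (0 \in mask) || uniq [:: nth 0 h 0; nth 0 h 1; nth 0 h 2] &
      all (fun x => (x.+1 \in mask) ||
                    uniq [:: nth 0 s x; nth 0 h x; nth 0 t x]) (iota 0 3)].

Fixpoint chain_ok (k : nat) (masks : seq (seq nat)) (s t : seq nat) : Prop :=
  if masks is b :: masks' then
    exists h r, block_ok k b s h r /\ chain_ok k masks' r t
  else s = t.

Lemma block_ok_sym k b s h t : block_ok k b s h t -> block_ok k b t h s.
Proof.
case/and3P=> /allP c hb /allP u; apply/and3P; split=> //; apply/allP => x xi.
  by have /and3P[-> -> ->] := c x xi.
have /orP[->//|] := u x xi; rewrite orbC -rev_uniq => ux.
by rewrite [X in X || _]ux.
Qed.

Lemma chain_ok_cat k A B s t : chain_ok k (A ++ B) s t <->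
  exists r, chain_ok k A s r /\ chain_ok k B r t.
Proof.
elim: A s => [|b A IH] s /=.
  by split=> [ct|[r [->]]] //; exists s.
split=> [[h [r [hr /IH[r' [rr' r't]]]]]|[r' [[h [r [hr rr']]] r't]]].
  by exists r'; split=> //; exists h, r.
by exists h, r; split=> //; apply/IH; exists r'.
Qed.

(** The first block is traversed forth, back and forth, by [block_ok_sym]. *)
Lemma chain_ok_extend k p B s t :
  chain_ok k (nseq p.+1 [::] ++ B) s t -> chain_ok k (nseq p.+3 [::] ++ B) s t.
Proof.
case=> h [r [hr rt]]; exists h, r; split=> //; exists h, s.
by split; [exact: block_ok_sym | exists h, r].
Qed.

(** Parity is kept, and a long stretch is never reduced to an empty one, which has no block to
    repeat. *)
Definition reduced (p : nat) : nat :=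
  if p <= 3 then p else if odd p then 3 else 2.

Lemma chain_ok_stretch k p B s t :
  chain_ok k (nseq (reduced p) [::] ++ B) s t -> chain_ok k (nseq p [::] ++ B) s t.
Proof.
elim/ltn_ind: p => p IH; have [p3|p3] := leqP p 3; first by rewrite /reduced p3.
case: p p3 IH => [|[|[|[|p]]]] // _ IH.
have -> : reduced p.+4 = reduced p.+2.
  by rewrite /reduced /=; case: p {IH} => [|[|p]] //=; rewrite negbK.
by move=> /IH - /(_ (leqW (ltnSn _))); apply: chain_ok_extend.
Qed.

Lemma chain_ok_stretch2 k p mid q s t :
  chain_ok k (nseq (reduced p) [::] ++ mid ++ nseq (reduced q) [::]) s t ->
  chain_ok k (nseq p [::] ++ mid ++ nseq q [::]) s t.
Proof.
move/chain_ok_stretch; rewrite !chain_ok_cat => -[r [sr]].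
rewrite chain_ok_cat => -[r' [rr' r't]]; exists r; split=> //.
rewrite chain_ok_cat; exists r'; split=> //.
by rewrite -[nseq q _]cats0; apply: chain_ok_stretch; rewrite cats0.
Qed.

Lemma chain_ok_colours k masks s t : chain_ok k masks s t ->
  exists (S H : nat -> seq nat), [/\ S 0 = s, S (size masks) = t &
    forall i, i < size masks -> block_ok k (nth [::] masks i) (S i) (H i) (S i.+1)].
Proof.
elim: masks s => [|b masks IH] s /=.
  by move=> <-; exists (fun=> s), (fun=> s).
case=> h [r [hr /IH[S [H [S0 St SH]]]]].
exists (fun i => if i is j.+1 then S j else s), (fun i => if i is j.+1 then H j else h).
by split=> // -[_|i iP] /=; rewrite ?S0 //; apply: SH.
Qed.

Section Removal.
Variable m : nat.
Hypothesis m_gt2 : 2 < m.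
Let m_gt1 : 1 < m := ltnW m_gt2.

Definition alive (rm : seq nat) (masks : seq (seq nat)) (v : vertex m) : bool :=
  match v with
  | inl a => val a \notin rm
  | inr (inl i) => 0 \notin nth [::] masks i
  | inr (inr (i, x)) => x.+1 \notin nth [::] masks i
  end.

(** The colourings of chain and core agree on the six end links and can be glued. *)
Lemma chain_colouring k rm masks (c : nat -> nat) (S : {set vertex m}) :
  size masks = m ->
  chain_ok k masks (map c [:: 72; 73; 74]) (map c [:: 75; 76; 77]) ->
  (forall e, e < 72 -> c e < k) ->
  (forall a, a < 50 -> a \notin rm -> uniq (map c (nth [::] core_inc a))) ->
  {in S, forall v, alive rm masks v} ->
  exists g, @colouring_on (graph m_gt2) k S g.
Proof.
move=> sm /chain_ok_colours[L [H [L0 Lm LH]]] ck cu Sa.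
rewrite sm in Lm LH.
pose g (e : edge m) := match e with
  | inl e => c e
  | inr (inl (i, x)) => nth 0 (H i) x
  | inr (inr (i, x)) => nth 0 (L i) x
  end.
have x3 (x : 'I_3) : val x \in iota 0 3 by rewrite mem_iota /= ltn_ord.
have gk e : g e < k.
  case: e => [e|[[i x]|[i x]]] /=; first exact: ck.
    by have /and3P[/allP/(_ _ (x3 x))/and3P[_ -> _] _ _] := LH i (ltn_ord i).
  case: (unliftP ord_max i) => [j ->|->].
    rewrite lift_max.
    by have /and3P[/allP/(_ _ (x3 x))/and3P[-> _ _] _ _] := LH j (ltn_ord j).
  (* The last link triple is bounded through the block to its left. *)
  case: m m_gt2 LH {Lm} => // n _ LH.
  by have /and3P[/allP/(_ _ (x3 x))/and3P[_ _ ->] _ _] := LH n (ltnSn n).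
have gE a : a < 78 -> g (decode m a) = c a.
  move=> a78; rewrite /decode; case: ltnP => a72; first by rewrite /= inordK.
  case: ltnP => a75; rewrite /= ?L0 ?Lm inordK; try lia.
    by have [->|[->|->]] : a = 72 \/ a = 73 \/ a = 74 by lia.
  by have [->|[->|->]] : a = 75 \/ a = 76 \/ a = 77 by lia.
apply: (igraph_colouring (ends_inj m_gt1) _ (mem_inc m_gt1) gk) => v vS.
have := Sa v vS; case: v vS => [a|[i|[i x]]] vS; rewrite [alive _ _ _]/=.
- move=> arm; have aP := ltn_ord a; have := cu _ aP arm; congr (is_true (uniq _)).
  by rewrite [inc _]/= -map_comp; apply/eq_in_map => e /(core_inc_lt aP) eP; rewrite /= gE.
- have /and3P[_ /orP[->//|+] _] := LH i (ltn_ord i).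
  by move=> + _; rewrite /= !inordK.
have /and3P[_ _ /allP/(_ _ (x3 x))/orP[->//|+]] := LH i (ltn_ord i).
move=> + _; rewrite -[map g _]/[:: nth 0 (L (lift ord_max i)) x; nth 0 (H i) x;
  nth 0 (L (lift ord0 i)) x].
by rewrite lift_max lift0.
Qed.

End Removal.

(** * Explicit colourings for short chains *)

Definition core_certificates : seq positive :=
  [:: 33866329005895727514057719800963330585140930311194112;
   37520518627310414806173262111270551774931589381333056;
   37520518627278693693898102196093364921179003509413952;
   38216820013018512908687246962255527232558332767182884;
   37520518627278693693898102196093364961659171933413476;
   36329324191502335662564605315752552940606291417563748;
   30735770708214482475063206090056771761658138656309668;
   30735770708230811127147176679425732409744871323083172;
   30735770708214482475063206090056771761658139033735588;
   30735770708213546283170424826496037146130424700883620;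
   36329324191502335662564605315752552874687678726672484;
   36329324191502335662564605315752552874688451913515620;
   36329324191502335662564605315752552820696116221317220;
   36329324191502335662564605315752552874687679196828260;
   30735770708214482475063206090056771761658138563317924;
   36329324191502335662564605315752552820697756158468196;
   36329324191502335662564605315752552820697807902609508;
   36329324191502335662564605315752552874687530584903780;
   36329324191502335662564605315752552820697662963191908;
   30735770708214482475063206090056771763239096968155300;
   36329324191502335662564605315752552874686036439601252;
   38303161362157038843534993826774953997466584888922660;
   36329324191501399470671824052191818257594950722015844;
   36329324191502335662564605315752552818973688860381284;
   30735770708214482475063206090056771708177601484165284;
   30735770708214482475063206090056771707226108927021220;
   36329324191502335662564605315752552972130117908767844;
   36329324191502335662564605315752552945107472365523044;
   36329324191502335662564605315752552836969351633047652;
   24837241425855563909526312335505729269961384347963556;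
   36329286251315622552560778294917253586743805123891364;
   36329286251315622552560778294943813439445433057677476;
   36720607618769184010509094615024688494925718925742244;
   36329286251330011422183757823887403346795860450480292;
   36329286251330011445534053126301285704610085628940452;
   36329286251315622544772519229701545191502706064625828;
   36329286251313615429564576886418856949765871656898724;
   36329286251330011426077901374533763829736920398041252;
   36329286251330011437745989042355602228419650948305060;
   36329286251330011422183771747839359089474068791300260;
   36329286251315622533104877142227081035827527083757732;
   36329286251330011422183757821013917128945976176152740;
   36329286251330011422183757958796042816392179753554084;
   36329286251315622544772491331662703727736995809988772;
   36329286251315622544772727778512438690273158836392100;
   36329286251330011422184245414949122113005409362383012;
   36329286251330011437745723491993403660418903288713380;
   36329286251330011422184203639006268054975990922088612;
   36329286251315622529210654570861214343402225966387364;
   36329286251330011437745292833930830701838739358224548;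
   35972501423558937681744832670664889354394749165244580;
   36329286251315622528987858715635357422310055400050852;
   36329286251330011421687301934877352124913131853320356;
   36329286251330011456892318156631949868915658680832164;
   36329286251330011425494999682445548160767826759913636;
   36329286251315622573086348907112512551089556599214244;
   36329286251330011458042889800002935815898381230149796;
   36329286251330011426874198584942335279784590072746148;
   39321715250802574112312590954396678478144107402531364;
   26333436947307282188366534567938485624672101782392932;
   27898705556300690053044709655573280999421485716476068;
   26333436947306206877773367948359141687348579619180708;
   30735770708214524659292328979549263567393845716324516;
   27898705556318927080293473367209979768227808135221412;
   33866307926185091881379747365656547799485936698790052;
   30735770708213857394007645397251888889645712118517924;
   26333436947318042323847836839291477185413315807285412;
   27898705556306070787118241660887254146340776642482340;
   30344436699580181277121509667638346338955286702067876;
   30517115182557159105796515357459359185761980599636132;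
   24837241413482939583414605545559199024187309627412644;
   24532265610421714167451226105319819917593233284534436]%positive.

Definition first_link_certificates : seq positive :=
  [:: 617517991713159223028616915403085917061586941307580926267556;
   410424336054274143167433618710298267511634998258762613395620;
   609504282672269171195717862651684289954447893298584318513316]%positive.

Definition last_link_certificates : seq positive :=
  [:: 505711713519669568089640729800514158964470447928031247208612;
   616075623551524248631020585368345546820247411158735395360932;
   410400034233913262250995060473422636603730749050642676191396]%positive.

(** Keyed by the reduced numbers of intact blocks before and after the damaged one, with one entry
    per rail. As [m] is even and above 3, these numbers differ in parity and their sum is not 1. *)
Definition spoke_certificates : seq (nat * nat * seq positive) :=
  [:: ((0, 3), [::
   609504919146172367871618732162896974180345247733818746867876;
   609504282672281397230823813338780650325495274752649323745444;
   609504919094394676075631919597864475780656463176125464842404]%positive);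
   ((3, 0), [:: 610854699622526025145934254857580822299145306652929614549156;
   608907318860399208538738753613302563549634116260047347912868;
   609915269911918094876297132672066080967997353832066044006564]%positive);
   ((1, 2), [:: 609504919186559195832119278917203292257857611608041328087204;
   609504282533061948293513662700831203721513721169330687053988;
   611242775659890429391971882980055575448433793595304134971556]%positive);
   ((2, 1), [:: 609504140036652308530479137841560013883919304715907746893988;
   609504944230851253134471685255546585684083436432101384523940;
   611241980035937086096394047912476862696553289141498929352868]%positive);
   ((2, 3), [::
   10254952075806844828537779156242051509472823815420712603685151445156;
   10225795681578673540166119407700168265558236091233648760345411850404;
   10225785003317505157891717137701498383332205044303709233286985683108]%positive);
   ((3, 2), [::
   10225795682256084459714494342121381349903271197555119537948132249764;
   10225785000982843982353839580046204084157905897384536351835404243108;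
   10254952075686160804694590408646331681084736967210736897813192773796]%positive)].

(** Two consecutive blocks are damaged, so the numbers of intact blocks on the two sides have equal
    parity and are not both 0. *)
Definition link_certificates : seq (nat * nat * seq positive) :=
  [:: ((0, 2), [::
   611242775839493851794397168452549223557988812062572587389092;
   609504919163079544039413532913913429774443967119408763375780;
   609504282742821687195123174500205376079567122373230192890020]%positive);
   ((2, 0), [:: 609793029447291214210329642647478544587022765344273117614244;
   610645100334503171384212927883303922926752997841146762104996;
   612425866730555951668452738297994377566069424895149568561316]%positive);
   ((1, 1), [:: 611242422473404752005972669877578901231479263542645799391396;
   609504354882429753280767446203485114363710462474286277202084;
   609504559540236281443529167354439657434932134676161152553124]%positive);
   ((1, 3), [::
   10254952078413583276161801423619984784311553800062281395690646409380;
   10225795680709362059772151894425237354673150635914445470146993983652;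
   10225795681578288849551147716757650364451307842082347004405179879588]%positive);
   ((3, 1), [::
   10254946150200202314283366234596050382785259954338796627584363139236;
   10254953237075215471210666073411346145627963274745337961300518899876;
   10225789648392041319267610104968798291533928719165948546894956728484]%positive);
   ((2, 2), [::
   10254948516964788854261518550669946707825761135805852451832640966820;
   10254952076102712248896199823958859882402030382183105425461723140260;
   10225795679187310029616203962285615126379375504520582531373037129892]%positive);
   ((3, 3), [::
   172049546089193623958790727885909448606323949181332058791186283692036591780;
   171560382907128000499638837570310864913835657401340359535780509516673978532;
   171560382921706172939947642744679381780093912931175775842761494060945772708]%positive)].

Definition four_colouring : positive :=
  36375693232359090968079647607331532176311400452984932%positive.

(* Base-4 digits, least significant first, below the leading one. *)
Fixpoint digits (p : positive) : seq nat :=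
  match p with
  | xO (xO p) => 0 :: digits p
  | xI (xO p) => 1 :: digits p
  | xO (xI p) => 2 :: digits p
  | xI (xI p) => 3 :: digits p
  | _ => [::]
  end.

Fixpoint walk_ok (k : nat) (masks : seq (seq nat)) (w : seq nat) : bool :=
  if masks is b :: masks' then
    block_ok k b (take 3 w) (take 3 (drop 3 w)) (take 3 (drop 6 w)) &&
    walk_ok k masks' (drop 6 w)
  else true.

(* A certificate lists the colours of the core edges and then, alternately,
   those of the links and of the spokes along the chain. *)
Definition certificate_colour (masks : seq (seq nat)) (w : seq nat) (e : nat) :=
  nth 0 w (if e < 75 then e else e + 6 * size masks - 3).

Definition certifies (k : nat) (rm : seq nat) (masks : seq (seq nat))
    (p : positive) : bool :=
  let w := digits p in let c := certificate_colour masks w in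
  [&& size w == 75 + 6 * size masks, all (gtn k) w,
      all (fun a => (a \in rm) || uniq (map c (nth [::] core_inc a))) (iota 0 50) &
      walk_ok k masks (drop 72 w)].

Lemma walk_chain_ok k masks w : walk_ok k masks w ->
  chain_ok k masks (take 3 w) (take 3 (drop (6 * size masks) w)).
Proof.
elim: masks w => [|b masks IH] w /=; first by rewrite muln0 drop0.
case/andP=> bw /IH ww; exists (take 3 (drop 3 w)), (take 3 (drop 6 w)); split=> //.
by move: ww; rewrite drop_drop mulnS addnC.
Qed.

Lemma take3_drop (w : seq nat) i : i + 3 <= size w ->
  take 3 (drop i w) = [:: nth 0 w i; nth 0 w i.+1; nth 0 w i.+2].
Proof.
move=> iw; do 3![rewrite (drop_nth 0) /=; last by lia].
by rewrite take0.
Qed.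

(** The certificate colours the core and a short chain, whose intact stretches are then prolonged to
    the lengths [p] and [q]. *)
Lemma certified_removal m (m_gt2 : 2 < m) k rm p mid q w (S : {set vertex m}) :
  0 < k -> p + size mid + q = m ->
  certifies k rm (nseq (reduced p) [::] ++ mid ++ nseq (reduced q) [::]) w ->
  {in S, forall v, alive rm (nseq p [::] ++ mid ++ nseq q [::]) v} ->
  exists g, @colouring_on (graph m_gt2) k S g.
Proof.
move=> k0 pqm; set masks := _ ++ _; case/and4P=> /eqP sw /all_nthP wk /allP cw ww Sa.
pose c := certificate_colour masks (digits w).
apply: (chain_colouring m_gt2 (c := c) _ _ _ _ Sa).
- by rewrite !size_cat !size_nseq addnA.
- apply: chain_ok_stretch2; move/walk_chain_ok: ww.
  rewrite drop_drop !take3_drop ?sw; try by lia.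
  congr chain_ok.
  rewrite /c /certificate_colour /=.
  by do ![congr cons]; congr (nth 0 _ _); lia.
- move=> e e72; rewrite /c /certificate_colour ifT; last by lia.
  by apply: wk; rewrite sw; lia.
move=> a a50 arm; have /orP[|//] := cw a (etrans (mem_iota 0 50 a) a50).
by rewrite (negPf arm).
Qed.

Lemma reducedP p :
  [/\ reduced p <= 3, odd (reduced p) = odd p & reduced p <= 1 -> reduced p = p].
Proof.
rewrite /reduced; have [p3|p3] := leqP p 3; first by split.
by case: (boolP (odd p)) => op; split.
Qed.

Lemma nth_masks p mid q i :
  nth [::] (nseq p [::] ++ mid ++ nseq q [::]) i =
  if i < p then [::] else nth [::] mid (i - p) :> seq nat.
Proof.
rewrite nth_cat size_nseq nth_nseq; case: ltnP => // pi.
rewrite nth_cat; case: ltnP => // im.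
by rewrite nth_nseq (nth_default _ im); case: ifP.
Qed.

Definition certificate_family (rm : nat -> seq nat) (mid : nat -> seq (seq nat))
    (pq : nat * nat) (ws : seq positive) : bool :=
  all (fun x => certifies 3 (rm x) (nseq pq.1 [::] ++ mid x ++ nseq pq.2 [::])
    (nth 1%positive ws x)) (iota 0 3).

(** Two intact blocks are enough, as [reduced] sends every positive even length to 2. *)
Lemma core_certificatesP : all (fun e => certifies 3 [:: core_src e; core_tgt e]
  [:: [::]; [::]] (nth 1%positive core_certificates e)) (iota 0 72).
Proof. by vm_compute. Qed.

Lemma first_link_certificatesP :
  certificate_family (fun x => [:: nth 0 left_ends x]) (fun x => [:: [:: x.+1]])
    (0, 3) first_link_certificates.
Proof. by vm_compute. Qed.

Lemma last_link_certificatesP :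
  certificate_family (fun x => [:: nth 0 right_ends x]) (fun x => [:: [:: x.+1]])
    (3, 0) last_link_certificates.
Proof. by vm_compute. Qed.

Lemma spoke_certificatesP :
  all (fun c => certificate_family (fun=> [::]) (fun x => [:: [:: 0; x.+1]]) c.1 c.2)
    spoke_certificates.
Proof. by vm_compute. Qed.

Lemma link_certificatesP :
  all (fun c => certificate_family (fun=> [::])
    (fun x => [:: [:: x.+1]; [:: x.+1]]) c.1 c.2)
    link_certificates.
Proof. by vm_compute. Qed.

Lemma four_colouringP : certifies 4 [::] [:: [::]; [::]] four_colouring.
Proof. by vm_compute. Qed.

Lemma all_has (T : Type) (P Q : pred T) s :
  all P s -> has Q s -> exists x, P x /\ Q x.
Proof.
elim: s => //= x s IH /andP[Px Ps] /orP[Qx|]; last exact: IH.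
by exists x.
Qed.

(** * Criticality and chromatic index *)

Section Critical.
Variable m : nat.
Hypotheses (m_gt3 : 3 < m) (m_even : ~~ odd m).
Let m_gt2 : 2 < m := ltnW m_gt3.
Let m_gt1 : 1 < m := ltnW m_gt2.

Definition removable (e : edge m) :=
  exists c, @colouring_on (graph m_gt2) 3 (~: ends (@src m) (@tgt m) e) c.

(** The last three hypotheses confine the vertices removed by the certificate to the ends of [e]. *)
Lemma certified_removable e rm p mid q w : p + size mid + q = m ->
  certifies 3 rm (nseq (reduced p) [::] ++ mid ++ nseq (reduced q) [::]) w ->
  (forall a, a \in rm -> core m a \in ends (@src m) (@tgt m) e) ->
  (forall (i : 'I_m), p <= i -> 0 \in nth [::] mid (i - p) ->
     hub i \in ends (@src m) (@tgt m) e) ->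
  (forall (i : 'I_m) (x : 'I_3), p <= i -> x.+1 \in nth [::] mid (i - p) ->
     rail i x \in ends (@src m) (@tgt m) e) ->
  removable e.
Proof.
move=> pqm cw Hc Hh Hr; apply: (certified_removal m_gt2 _ pqm cw) => // v.
rewrite inE; apply: contraR; case: v => [a|[i|[i x]]]; rewrite [alive _ _ _]/= negbK.
- by move/Hc; rewrite /core inord_val.
- by rewrite nth_masks; case: ltnP => // pi; apply: Hh.
by rewrite nth_masks; case: ltnP => // pi; apply: Hr.
Qed.

Lemma reduced_even p : ~~ odd p -> 1 < p -> reduced p = 2.
Proof. by case: p => [|[|[|[|p]]]] // op _; rewrite /reduced (negPf op). Qed.

Lemma reduced_odd p : odd p -> 2 < p -> reduced p = 3.
Proof. by case: p => [|[|[|[|p]]]] // op _; rewrite /reduced op. Qed.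

Lemma core_edge_removable (e : 'I_72) : removable (inl e).
Proof.
have /allP/(_ (val e)) := core_certificatesP; rewrite mem_iota ltn_ord => /(_ isT) cw.
apply: (@certified_removable _ [:: core_src e; core_tgt e] m [::] 0 _ _ _) => //.
- by rewrite !addn0.
- by rewrite reduced_even //; exact: cw.
- by move=> a; rewrite !inE => /orP[]/eqP->; rewrite eqxx ?orbT.
- by move=> i _; rewrite nth_nil.
by move=> i x _; rewrite nth_nil.
Qed.

Lemma certificate_pick rm mid pq ws (x : 'I_3) : certificate_family rm mid pq ws ->
  certifies 3 (rm x) (nseq pq.1 [::] ++ mid x ++ nseq pq.2 [::]) (nth 1%positive ws x).
Proof. by move/allP/(_ (val x)); apply; rewrite mem_iota ltn_ord. Qed.

Lemma spoke_removable (i : 'I_m) (x : 'I_3) : removable (spoke i x).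
Proof.
have im := ltn_ord i; set q := m.-1 - i.
have pqE : has (fun c => c.1 == (reduced i, reduced q)) spoke_certificates.
  have [p3 po p1] := reducedP i; have [q3 qo q1] := reducedP q.
  have odd_pq : odd (reduced i) != odd (reduced q).
    by rewrite po qo /q; move: im m_gt3 m_even; clear; lia.
  (* A reduced length of at most 1 is the true length, whereas [i + q] is [m - 1], hence at least
     3. *)
  have pq1 : reduced i + reduced q != 1.
    by apply/eqP; move: im m_gt3 p1 q1; rewrite /q; clear; lia.
  (* Six pairs of values remain, each with its entry in the table. *)
  by move: (reduced i) (reduced q) p3 q3 odd_pq pq1 {p1 q1 po qo}
    => [|[|[|[|p']]]] [|[|[|[|q']]]].
have [[pq ws] [/(certificate_pick x) + /eqP pq']] := all_has spoke_certificatesP pqE.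
rewrite /= in pq'; rewrite {}pq' => cw.
apply: (@certified_removable _ [::] i [:: [:: 0; x.+1]] q (nth 1%positive ws x)) => //.
- by rewrite /q /=; move: im; clear; lia.
- move=> j ij; case: (j - i) (subnKC ij) => [|k] /=; last by rewrite nth_nil.
  by rewrite addn0 => /val_inj-> _; rewrite !inE eqxx.
move=> j y ij; case: (j - i) (subnKC ij) => [|k] /=; last by rewrite nth_nil.
rewrite addn0 => /val_inj->; rewrite !inE /= eqSS => /eqP/val_inj->.
by rewrite eqxx.
Qed.

Lemma link_removable (j : 'I_m.+1) (x : 'I_3) : removable (link j x).
Proof.
case: (unliftP ord0 j) => [k jk|j0]; case: (unliftP ord_max j) => [l jl|jm].
(* An inner link, from block [k] to the next one. *)
- have kl : l = k.+1 :> nat.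
    by move: (congr1 (@nat_of_ord _) jl); rewrite jk lift0 lift_max.
  have lm := ltn_ord l; set q := m.-2 - k.
  have pqE : has (fun c => c.1 == (reduced k, reduced q)) link_certificates.
    have [p3 po p1] := reducedP k; have [q3 qo q1] := reducedP q.
    have odd_pq : odd (reduced k) == odd (reduced q).
      by rewrite po qo; move: kl lm m_gt3 m_even; rewrite /q /=; clear; lia.
    have pq1 : reduced k + reduced q != 0.
      move: (reduced k) (reduced q) p1 q1 => rk rq p1 q1.
      by apply/eqP; move: kl lm m_gt3 p1 q1; rewrite /q /=; clear; lia.
    by move: (reduced k) (reduced q) p3 q3 odd_pq pq1 {p1 q1 po qo}
      => [|[|[|[|p']]]] [|[|[|[|q']]]].
  have [[pq ws] [/(certificate_pick x) + /eqP pq']] := all_has link_certificatesP pqE.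
  rewrite /= in pq'; rewrite {}pq' => cw.
  have sE : src (link j x) = rail k x by rewrite jk src_linkS.
  have tE : tgt (link j x) = rail l x by rewrite jl tgt_link.
  apply: (@certified_removable _ [::] k [:: [:: x.+1]; [:: x.+1]] q
    (nth 1%positive ws x)) => //.
  + by move: kl lm; rewrite /q /=; clear; lia.
  + by move=> i _; case: (i - k) => [|[|n]] //=; rewrite nth_nil.
  move=> i y ki; rewrite !inE sE tE.
  case: (i - k) (subnKC ki) => [|[|n]] /= iE; last by rewrite nth_nil.
    rewrite inE eqSS => /eqP/val_inj ->; apply/orP; left.
    by rewrite addn0 in iE; rewrite (val_inj iE).
  rewrite inE eqSS => /eqP/val_inj ->; apply/orP; right.
  by rewrite addn1 -kl in iE; rewrite (val_inj iE).
(* The link that leaves the last block; the other blocks are odd in number, hence reduced to 3. *)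
- have cw := certificate_pick x last_link_certificatesP.
  have tE : tgt (link j x) = core m (nth 0 right_ends x) by rewrite jm tgt_link_max.
  have sE : src (link j x) = rail k x by rewrite jk src_linkS.
  have km : k.+1 = m by move: (congr1 (@nat_of_ord _) jm); rewrite jk lift0.
  apply: (@certified_removable _ _ m.-1 [:: [:: x.+1]] 0
    (nth 1%positive last_link_certificates x)).
  + by rewrite /= addn0 addn1 prednK //; move: m_gt3; clear; lia.
  + by rewrite reduced_odd; [exact: cw | move: m_even m_gt3; clear; lia ..].
  + by move=> a; rewrite inE => /eqP->; rewrite !inE tE eqxx orbT.
  + by move=> i _; case: (i - _) => [|n] //=; rewrite nth_nil.
  move=> i y mi; rewrite !inE sE; have im := ltn_ord i.
  have -> : i - m.-1 = 0 by move: im mi; clear; lia.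
  rewrite /= inE eqSS => /eqP/val_inj ->; apply/orP; left.
  have ik : i = k :> nat by move: km im mi => /=; clear; lia.
  by rewrite (val_inj ik).
(* The link that enters the first block. *)
- have cw := certificate_pick x first_link_certificatesP.
  have tE : tgt (link j x) = rail l x by rewrite jl tgt_link.
  have sE : src (link j x) = core m (nth 0 left_ends x) by rewrite j0 src_link0.
  have l0 : l = 0 :> nat by move: (congr1 (@nat_of_ord _) j0); rewrite jl lift_max.
  apply: (@certified_removable _ _ 0 [:: [:: x.+1]] m.-1
    (nth 1%positive first_link_certificates x)).
  + by rewrite /= add1n prednK //; move: m_gt3; clear; lia.
  + by rewrite (@reduced_odd m.-1); [exact: cw | move: m_even m_gt3; clear; lia ..].
  + by move=> a; rewrite inE => /eqP->; rewrite !inE sE eqxx.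
  + by move=> i _; case: (i - _) => [|n] //=; rewrite nth_nil.
  move=> i y _; rewrite !inE tE subn0.
  case iE: (nat_of_ord i) => [|n] /=; last by rewrite nth_nil.
  rewrite inE eqSS => /eqP/val_inj ->; apply/orP; right.
  by rewrite -l0 in iE; rewrite (val_inj iE).
- by move/eqP: jm; rewrite j0 eq_sym ord0_max.
Qed.

Lemma graph_critical : critical (graph m_gt2).
Proof.
move=> u v nuv /iadjP[e eE]; apply/edge_colourable_induced.
rewrite -[[set u; v]]eE; case: e {eE} => [e|[[i x]|[j x]]].
- exact: core_edge_removable.
- exact: spoke_removable.
exact: link_removable.
Qed.

Lemma graph_not_3_colourable : ~ edge_colourable (graph m_gt2) 3.
Proof.
move/edge_colourableP => -[c cP]; apply: (@not_colourable_apart m m_gt2 m_even).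
by exists c; apply: colouring_onS cP; apply: subsetT.
Qed.

Lemma graph_not_bicritical : ~ bicritical (graph m_gt2).
Proof.
move=> /(_ (core m 0) (core m 1)).
rewrite /remove_pair => /(_ _)/wrap[]; first by rewrite coreE.
by move/edge_colourable_induced; apply: (@not_colourable_apart m m_gt2 m_even).
Qed.

Lemma graph_chromatic_index : has_chromatic_index (graph m_gt2) 4.
Proof.
split.
  apply/edge_colourableP; apply: (@certified_removal _ m_gt2 4 [::] m [::] 0) => //.
  - by rewrite !addn0.
  - by rewrite reduced_even //; exact: four_colouringP.
  by case=> [a|[i|[i x]]] _; rewrite /alive ?nth_masks ?nth_nil ?if_same.
move=> k [c [ck cu]]; rewrite leqNgt; apply/negP => k4.
apply: graph_not_3_colourable; exists c; split=> // e eG.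
by apply: leq_trans (ck e eG) _.
Qed.

End Critical.

Theorem theorem3 (n : nat) (hn : 66 <= n) (hmod : n = 2 %[mod 8]) :
  exists G : sgraph,
    [/\ snark G, strictly_critical G, cyclically_connected G 5,
        has_girth G 6 & #|G| = n].
Proof.
(* The order of the graph is $50 + 4m$; the bound on [n] gives $m \ge 4$ and its residue modulo 8
   makes [m] even. *)
pose m := (n - 50) %/ 4.
have nE : 50 + 4 * m = n by rewrite /m; lia.
have m_gt3 : 3 < m by rewrite /m; lia.
have m_even : ~~ odd m by rewrite /m; lia.
exists (graph (ltnW m_gt3)); split.
- split; [exact: graph_connected | exact: graph_cubic | exact: graph_chromatic_index].
- split; [exact: graph_critical | exact: graph_not_bicritical].
- exact: graph_cyclically_connected.
- exact: graph_girth.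
exact: etrans (card_vertex m) nE.
Qed.
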